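(* Let $n\ge2$, $\alpha>n$, $0\leq\beta<\frac{\alpha-n}{n-1}$, $p\in(0,1)$ with $p>\frac{n-1}{\alpha-1-(n-1)\beta}$, and let $q<0$ be given by $$\frac1q=\frac{n-1}{n}\left(\frac1p-\frac{\alpha+\beta-1}{n-1}\right)$$ (so that $\beta q+1>0$). Define $$C^*_{n,\alpha,\beta,p}:=\inf\left\{\|Tf\|_{L^q(\mathbb{R}^n_+)}\ :\ f\geq0,\ \|f\|_{L^p(\partial\mathbb{R}^n_+)}=1\right\}.$$ Then there exists a function $f\in L^p(\partial\mathbb{R}^n_+)$ with $f\geq 0$ and $\|f\|_{L^p(\partial\mathbb{R}^n_+)}=1$ such that $\|Tf\|_{L^q(\mathbb{R}^n_+)}=C^*_{n,\alpha,\beta,p}$.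
   Context: $\mathbb{R}^n_+=\{x\in\mathbb{R}^n: x_n>0\}$, and $\partial\mathbb{R}^n_+=\{x_n=0\}$ is identified with $\mathbb{R}^{n-1}$ with Lebesgue measure. For nonnegative measurable $f$ on $\partial\mathbb{R}^n_+$, $$Tf(x):=\int_{\partial\mathbb{R}^n_+}\frac{x_n^\beta}{|x-y|^{n-\alpha}}f(y)\,dy,\qquad x\in\mathbb{R}^n_+ .$$ For a nonzero real exponent $s$ (possibly less than $1$ or negative) and a nonnegative measurable $h$, $\|h\|_{L^s}=(\int h^s)^{1/s}$, with the conventions, for $s<0$, $0^s=+\infty$, $(+\infty)^s=0$. *)

(* Defs.v *)
From HB Require Import structures.
From mathcomp Require Import all_boot all_order all_algebra.
From mathcomp Require Import all_classical all_reals all_analysis.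
From mathcomp Require Import ring lra.

Set Implicit Arguments.
Unset Strict Implicit.
Unset Printing Implicit Defensive.

Import Order.TTheory GRing.Theory Num.Theory.
Import numFieldNormedType.Exports.

Local Open Scope classical_set_scope.
Local Open Scope ring_scope.

(* R^n with its Borel sigma-algebra: the library equips tuples with the
   product sigma-algebra. The coordinates x_1, ..., x_n of x are
   x`_0, ..., x`_n.-1. *)
Notation Rn R n := (n.-tuple (measurableTypeR R)) (only parsing).

Section LebesgueSucc.
Context (R : realType) (n : nat).
Variable mu : {sigma_finite_measure set (Rn R n) -> \bar R}.

Definition tuple_of_pair (x : measurableTypeR R * Rn R n) : Rn R n.+1 :=
  [tuple of x.1 :: x.2].

Lemma measurable_tuple_of_pair : measurable_fun [set: _] tuple_of_pair.
Proof. exact: measurable_cons. Qed.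

Definition lebesgue_succ : set (Rn R n.+1) -> \bar R :=
  pushforward (lebesgue_measure \x mu)%E tuple_of_pair.

Let measurable_preimage A :
  measurable A -> measurable (tuple_of_pair @^-1` A).
Proof.
by move=> mA; rewrite -[X in measurable X]setTI; exact: measurable_tuple_of_pair.
Qed.

Let lebesgue_succ0 : lebesgue_succ set0 = 0%E.
Proof. by rewrite /lebesgue_succ /pushforward preimage_set0 measure0. Qed.

Let lebesgue_succ_ge0 A : (0 <= lebesgue_succ A)%E.
Proof. by rewrite /lebesgue_succ /pushforward measure_ge0. Qed.

Let lebesgue_succ_sigma_additive : semi_sigma_additive lebesgue_succ.
Proof.
move=> F mF tF mUF; rewrite /lebesgue_succ /pushforward preimage_bigcup.
apply: measure_semi_sigma_additive.
- by move=> k; exact: measurable_preimage.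
- apply/trivIsetP => /= i j _ _ ij; rewrite -preimage_setI.
  by move/trivIsetP : tF => /(_ _ _ _ _ ij) ->//; rewrite preimage_set0.
- by rewrite -preimage_bigcup; exact: measurable_preimage.
Qed.

HB.instance Definition _ := isMeasure.Build _ _ _ lebesgue_succ
  lebesgue_succ0 lebesgue_succ_ge0 lebesgue_succ_sigma_additive.

Let lebesgue_succ_sigma_finite : sigma_finite setT lebesgue_succ.
Proof.
have /sigma_finiteP[F [TF ndF Foo]] := sigma_finiteT (@lebesgue_measure R).
have /sigma_finiteP[G [TG ndG Goo]] := sigma_finiteT mu.
pose g (x : Rn R n.+1) : measurableTypeR R * Rn R n :=
  (thead x, [tuple of behead x]).
have mg : measurable_fun [set: _] g.
  apply/measurable_fun_pairP; split; first exact: measurable_tnth.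
  exact: measurable_behead.
have gK : cancel tuple_of_pair g.
  by move=> [x y]; congr (_, _); apply/val_inj.
exists (fun k => g @^-1` (F k `*` G k)).
  rewrite -preimage_bigcup (_ : \bigcup_k _ = setT) ?preimage_setT//.
  apply/seteqP; split => // -[x y] _.
  have [i _ Fi] : (\bigcup_k F k) x by rewrite -TF.
  have [j _ Gj] : (\bigcup_k G k) y by rewrite -TG.
  exists (maxn i j) => //; split => /=.
    by move: x Fi; exact/subsetPset/ndF/leq_maxl.
  by move: y Gj; exact/subsetPset/ndG/leq_maxr.
move=> k; have [mF ltF] := Foo k; have [mG ltG] := Goo k; split.
  by rewrite -[X in measurable X]setTI; apply: mg => //; exact: measurableX.
rewrite /lebesgue_succ /pushforward -comp_preimage.
rewrite (_ : g \o _ = id); last by apply/funext => x /=; rewrite gK.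
by rewrite preimage_id product_measure1E// lte_mul_pinfty// ge0_fin_numE.
Qed.

HB.instance Definition _ := Measure_isSigmaFinite.Build _ _ _ lebesgue_succ
  lebesgue_succ_sigma_finite.
End LebesgueSucc.

Fixpoint lebesgue_tuple (R : realType) (n : nat) :
    {sigma_finite_measure set (Rn R n) -> \bar R} :=
  match n with
  | 0 => (\d_ ([tuple] : Rn R 0) : {sigma_finite_measure set _ -> \bar R})
  | m.+1 => lebesgue_succ (lebesgue_tuple R m)
  end.

Lemma lebesgue_tuple_box (R : realType) (n : nat)
    (A : 'I_n -> set (measurableTypeR R)) : (forall i, measurable (A i)) ->
  lebesgue_tuple R n [set x | forall i, A i (tnth x i)] =
  (\prod_(i < n) lebesgue_measure (A i))%E.
Proof.
elim: n A => [|n IHn] A mA /=.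
  rewrite big_ord0 diracE mem_set//=; by case.
rewrite big_ord_recl -IHn//.
rewrite /lebesgue_succ /pushforward -product_measure1E//.
  congr (_ _); apply/seteqP; split => [x /= Ax|x /= [A0 AS] i].
    split; first exact: (Ax ord0).
    by move=> i; have := Ax (lift ord0 i); rewrite tnthS.
  have [->//|i0] := eqVneq i ord0.
  have [j -> {i i0}] : exists j, i = lift ord0 j.
    by case: (unliftP ord0 i) i0 => [j ->|->]; [exists j|rewrite eqxx].
  by rewrite tnthS; exact: AS.
rewrite (_ : [set _ | _] =
    \bigcap_(i in [set: 'I_n]) ((fun x => tnth x i) @^-1` A (lift ord0 i))).
  apply: fin_bigcap_measurable => // i _.
  by rewrite -[X in measurable X]setTI; exact: measurable_tnth.
by apply/seteqP; split => x /= Ax i *; exact: Ax.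
Qed.

(* x^s for x in [0, +oo] and s != 0. The library's [poweR] gives 0 `^ s = 0 and
   +oo `^ s = +oo also for s < 0; here 0^s = +oo and (+oo)^s = 0 for s < 0. *)
Definition epow (R : realType) (x : \bar R) (s : R) : \bar R :=
  if (s < 0)%R then
    if x == 0%E then +oo%E else if x == +oo%E then 0%E else (x `^ s)%E
  else (x `^ s)%E.

(* ||h||_{L^s(D, mu)} for h >= 0 and s != 0, any sign; unlike ['N[mu]_s[h]] it
   obeys the above conventions when s < 0. *)
Definition Lsnorm d (T : measurableType d) (R : realType)
    (mu : {measure set T -> \bar R}) (D : set T) (s : R) (h : T -> \bar R) :
    \bar R :=
  epow (\int[mu]_(x in D) epow (h x) s)%E s^-1.

Lemma Lsnorm_Lnorm d (T : measurableType d) (R : realType)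
    (mu : {measure set T -> \bar R}) (s : R) (h : T -> \bar R) :
  (0 < s)%R -> (forall x, 0 <= h x)%E ->
  Lsnorm mu setT s h = ('N[mu]_s%:E[h])%E.
Proof.
move=> s0 h0; rewrite unlock /Lsnorm /epow.
rewrite !ltNge invr_ge0 (ltW s0)/=; congr (_ `^ _)%E.
by apply: eq_integral => x _; rewrite gee0_abs.
Qed.

Section HalfSpace.
Context (R : realType) (n : nat).

Definition half_space : set (Rn R n) := [set x | (0 : R) < x`_n.-1].

(* R^{n-1} identified with the boundary {x_n = 0} *)
Definition boundary_point (y : Rn R n.-1) : Rn R n :=
  [tuple (if (i < n.-1)%N then y`_i else 0 : R) | i < n].

Definition edist (x z : Rn R n) : R :=
  Num.sqrt (\sum_(i < n) ((tnth x i : R) - tnth z i) ^+ 2).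

Definition T_op (alpha beta : R) (f : Rn R n.-1 -> R) (x : Rn R n) : \bar R :=
  (\int[lebesgue_tuple R n.-1]_y
     ((x`_n.-1 : R) `^ beta / edist x (boundary_point y) `^ (n%:R - alpha)
      * f y)%:E)%E.

Definition Lp_boundary (p : R) (f : Rn R n.-1 -> R) : \bar R :=
  Lsnorm (lebesgue_tuple R n.-1) setT p (EFin \o f).

Definition Lq_half_space (q : R) (g : Rn R n -> \bar R) : \bar R :=
  Lsnorm (lebesgue_tuple R n) half_space q g.

Definition admissible (p : R) (f : Rn R n.-1 -> R) : Prop :=
  [/\ measurable_fun [set: Rn R n.-1] f, forall y, 0 <= f y &
      Lp_boundary p f = 1%E].

Definition Cstar (alpha beta p q : R) : \bar R :=
  ereal_inf [set Lq_half_space q (T_op alpha beta f) | f in admissible p].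

End HalfSpace.
Arguments half_space R n : clear implicits.
Arguments Lp_boundary {R} n p f.
Arguments Lq_half_space {R} n q g.
Arguments T_op {R} n alpha beta f x.
Arguments admissible {R} n p f.
Arguments Cstar {R} n alpha beta p q.

Lemma beta_q_gt0 (R : realType) (n : nat) (alpha beta p q : R) :
  (2 <= n)%N -> n%:R < alpha ->
  0 <= beta -> beta < (alpha - n%:R) / (n%:R - 1) ->
  (n%:R - 1) / (alpha - 1 - (n%:R - 1) * beta) < p -> p < 1 ->
  q < 0 ->
  q^-1 = (n%:R - 1) / n%:R * (p^-1 - (alpha + beta - 1) / (n%:R - 1)) ->
  0 < beta * q + 1.
Proof.
move=> n2 an b0 bu pl p1 q0 qE.
have n2R : 2 <= n%:R :> R by rewrite (ler_nat R 2 n).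
set N : R := n%:R in an bu pl qE n2R *.
have N1 : 0 < N - 1 by lra.
have D0 : 0 < alpha - 1 - (N - 1) * beta.
  by move: bu; rewrite ltr_pdivlMr// => bu; nra.
have p0 : 0 < p by apply: lt_trans pl; exact: divr_gt0.
have ip : p^-1 < (alpha - 1 - (N - 1) * beta) / (N - 1).
  by rewrite -[ltRHS]invrK ltf_pV2 ?posrE ?invr_gt0 ?divr_gt0// invf_div.
have : q^-1 < - beta.
  have N0 : N != 0 by rewrite gt_eqF//; lra.
  have N10 : N - 1 != 0 by rewrite gt_eqF.
  rewrite qE.
  have -> : - beta = (N - 1) / N * ((alpha - 1 - (N - 1) * beta) / (N - 1)
                       - (alpha + beta - 1) / (N - 1)) by field; rewrite N0 N10.
  by rewrite ltr_pM2l ?ltrD2r// divr_gt0//; lra.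
move=> qb; have : q * - beta < q * q^-1 by rewrite ltr_nM2l.
by rewrite mulfV ?lt_eqF// => ?; nra.
Qed.

(* Main.v *)
From mathcomp Require Import all_boot all_order all_algebra.
From mathcomp Require Import all_classical all_reals all_analysis.
From mathcomp Require Import measurable_realfun measurable_fun_approximation.
From mathcomp Require Import ring lra.
Require Import Defs.

Set Implicit Arguments.
Unset Strict Implicit.
Unset Printing Implicit Defensive.

Import Order.TTheory GRing.Theory Num.Theory.
Import numFieldNormedType.Exports.

Local Open Scope classical_set_scope.
Local Open Scope ring_scope.

(** Write [m = n - 1], [lambda = alpha - n], and [gam = 1 / (1 - p)]. Since [q < 0],
    one has to maximize the energy [\int (T f) `^ q] over the half-space among
    nonnegative [f] with [\int f `^ p = 1]. The problem is invariant under
    translations along the boundary and under dilations; compactness is recovered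
    modulo this group without any rearrangement, as follows.

    Given a competitor [f], freeze [g = (T f) `^ (q - 1)] on a bounded set [A] where
    everything is finite, and let [u = \int_A K(x, .) g(x) dx] be its potential. The
    function proportional to [u `^ (- gam)] with the same [p]-norm minimizes
    [h |-> \int u h], and convexity of [t |-> t `^ q] shows that its energy is at
    least [\int_A (T f) `^ q] ([transform_improvement]). So one may restrict to
    negative powers of potentials.

    Now [u(y) = \int |x - y| `^ lambda d nu(x)] with a kernel that grows at infinity.
    From [|y - z| <= |x - y| + |x - z|] and [|x - y| <= |x - z| + |y - z|] it follows
    that, around a near-minimum point [a] and with [N] the mass of [nu], the function
    [u] is comparable to [N * |y - a| `^ lambda + u(a)] with constants depending on
    [lambda] only ([affine_normalization]). A translation and a dilation, under which
    the normalized problem is invariant ([energy_dilation]), turn this into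
    [(1 + |y|) `^ lambda], and a multiplicative constant restores the normalization
    ([mass_normalization]). All competitors are thereby reduced to
    [F = u `^ (- gam)] with [u] in one fixed class of functions
    ([truncation_reduction]), whose members have uniform two-sided bounds and a
    common modulus of continuity. The class is sequentially compact for pointwise
    convergence ([tame_subsequence]).

    On this class everything is dominated. The functions [F `^ p], and
    [K(x, .) F] for each [x], are at most constant multiples of
    [(1 + |y|) `^ (- lambda * (gam - 1))], integrable since
    [p > m / (alpha - 1)]; and [T F >= k * x_n `^ beta * (1 + |x|) `^ lambda] for some
    [k > 0], so that [(T F) `^ q] is bounded by a multiple of
    [x_n `^ (beta * q) * (1 + |x|) `^ (lambda * q)], integrable since
    [beta * q > - 1] and, thanks to [p < 1], [(lambda + beta) * q < - n]. Dominated
    convergence yields a maximizer in the class ([energy_attained]). Letting [A]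
    exhaust the half-space shows that it is a maximizer among all [f]
    ([energy_maximizer]). *)

(** * Integrals of powers on the line *)

Lemma ge0_integral_bigcup_le d (T : measurableType d) (R : realType)
    (mu : {measure set T -> \bar R}) (F : (set T)^nat) (f : T -> \bar R)
    (c : \bar R) :
  nondecreasing_seq F -> (forall k, measurable (F k)) ->
  measurable_fun [set: T] f -> (forall x, (0 <= f x)%E) ->
  (forall k, (\int[mu]_(x in F k) f x <= c)%E) ->
  (\int[mu]_(x in \bigcup_k F k) f x <= c)%E.
Proof.
move=> ndF mF mf f0 Fc.
have cv := @ge0_nondecreasing_set_cvg_integral _ _ _ F f mu ndF mF
  (fun i => measurable_funTS mf) (fun i x _ => f0 x).
rewrite -(cvg_lim _ cv)//; apply: lime_le; first by apply/cvg_ex; eexists; exact: cv.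
exact: nearW.
Qed.

Section one_dimensional_integrals.
Context (R : realType).
Notation mu := (@lebesgue_measure R).

Lemma integral_powR_itv (a x y : R) : a != 0 -> 0 < x -> x <= y ->
  (\int[mu]_(t in `[x, y]) (t `^ (a - 1))%:E = ((y `^ a - x `^ a) / a)%:E)%E.
Proof.
move=> a0 x0; rewrite le_eqVlt => /predU1P[<-|xy].
  by rewrite set_itv1 integral_set1 subrr mul0r.
have D (t : R) : 0 < t -> is_derive t 1 (fun u : R => u `^ a / a) (t `^ (a - 1)).
  move=> t0; have H := is_derive1_powR a t0.
  have -> : (fun u : R => u `^ a / a) = (a^-1 *: ((fun u : R => u `^ a) : R -> R^o)).
    by apply/funext => u; rewrite [LHS]mulrC.
  have -> : t `^ (a - 1) = a^-1 *: (a * t `^ (a - 1) : R^o).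
    by rewrite -[RHS]/(a^-1 * _) mulKf.
  exact: is_deriveZ.
have C (b : R) : {within `[x, y], continuous (fun u : R => u `^ b)}.
  apply: derivable_within_continuous => t; rewrite in_itv/= => /andP[xt _].
  by have [] := is_derive1_powR b (lt_le_trans x0 xt).
have ct b : {in `]x, y[, continuous (fun u : R => u `^ b)} /\
     (u `^ b @[u --> x^'+] --> x `^ b) /\ (u `^ b @[u --> y^'-] --> y `^ b).
  by have /continuous_within_itvP[]// := C b.
rewrite (@continuous_FTC2 _ _ (fun u => u `^ a / a) _ _ xy).
- by rewrite -EFinD -mulNr -mulrDl.
- exact: C.
- split.
  + move=> t; rewrite in_itv/= => /andP[xt _].
    by have [] := D t (lt_trans x0 xt).
  + by apply: cvgMl; have [_ []] := ct a.
  + by apply: cvgMl; have [_ []] := ct a.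
- move=> t; rewrite in_itv/= => /andP[xt _].
  rewrite derive1E; have H := D t (lt_trans x0 xt); exact: derive_val.
Qed.

Lemma integral_powR_near0 (b : R) : -1 < b ->
  (\int[mu]_(t in `]0%R, 1%R]) (t `^ b)%:E < +oo)%E.
Proof.
move=> b1; have a0 : 0 < b + 1 by lra.
apply: (@le_lt_trans _ _ (b + 1)^-1%:E); last by rewrite ltry.
have -> : `]0%R, 1%R]%classic = \bigcup_k `[(k.+1%:R^-1 : R), 1%R]%classic.
  apply/seteqP; split => [t /=|t [k _]/=]; rewrite !in_itv/= => /andP[t0 t1].
    exists (Num.truncn (t^-1)) => //=; rewrite in_itv/= t1 andbT.
    rewrite -[leRHS]invrK lef_pV2 ?posrE ?invr_gt0//.
    by apply: ltW; exact: truncnS_gt.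
  by rewrite t1 andbT (lt_le_trans _ t0)// invr_gt0.
apply: ge0_integral_bigcup_le => //.
- apply/nondecreasing_seqP => k; apply/subsetPset => t /=; rewrite !in_itv/=.
  move=> /andP[h ->]; rewrite andbT (le_trans _ h)//.
  by rewrite lef_pV2 ?posrE// ler_nat.
- by apply/measurable_EFinP; exact: measurable_powR.
- by move=> t; rewrite lee_fin powR_ge0.
move=> k; have -> : b = (b + 1) - 1 by rewrite addrK.
rewrite integral_powR_itv// ?gt_eqF ?invr_gt0 ?invf_le1 ?ler1n//.
rewrite addrK lee_fin ler_pdivrMr ?mulVf ?gt_eqF//.
by rewrite powR1 lerBlDr lerDl powR_ge0.
Qed.

Lemma integral_powR_nearoo (b : R) : b < -1 ->
  (\int[mu]_(t in `[1%R, +oo[) (t `^ b)%:E < +oo)%E.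
Proof.
move=> b1; have a0 : 0 < - (b + 1) by lra.
apply: (@le_lt_trans _ _ (- (b + 1))^-1%:E); last by rewrite ltry.
have -> : `[1%R, +oo[%classic = \bigcup_k `[1%R, (k.+1%:R : R)]%classic.
  apply/seteqP; split => [t /=|t [k _]/=]; rewrite !in_itv/= ?andbT.
    move=> t1; exists (Num.truncn t) => //=; rewrite in_itv/= t1/=.
    by apply: ltW; exact: truncnS_gt.
  by move=> /andP[].
apply: ge0_integral_bigcup_le => //.
- apply/nondecreasing_seqP => k; apply/subsetPset => t /=; rewrite !in_itv/=.
  by move=> /andP[->/=] h; rewrite (le_trans h)// ler_nat.
- by apply/measurable_EFinP; exact: measurable_powR.
- by move=> t; rewrite lee_fin powR_ge0.
move=> k; have -> : b = (b + 1) - 1 by rewrite addrK.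
rewrite integral_powR_itv// ?lt_eqF ?ler1n//; last by lra.
rewrite addrK lee_fin powR1.
set X := _ `^ _; have X0 : 0 <= X by exact: powR_ge0.
have -> : (X - 1) / (b + 1) = (1 - X) / - (b + 1) by rewrite invrN mulrN -mulNr opprB.
by rewrite ler_pdivrMr// mulVf ?gt_eqF//; lra.
Qed.

(** The only one-variable integral behind the whole proof: [b = 0] measures decay
    at infinity, while [b = beta * q] adds the singularity at the boundary of the
    half-space, integrable because [beta * q + 1 > 0]. *)
Lemma integral_powR_mul_lty (b c : R) : -1 < b -> 0 <= c -> b - c < -1 ->
  (\int[mu]_(t in `]0%R, +oo[) (t `^ b * (1 + t) `^ (- c))%:E < +oo)%E.
Proof.
move=> b1 c0 bc.
have mh : measurable_fun [set: R] (fun t : R => t `^ b * (1 + t) `^ (- c)).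
  apply: measurable_funM; first exact: measurable_powR.
  apply: (measurableT_comp (measurable_powR _)).
  exact: measurable_funD.
have h0 (t : R) : (0 <= (t `^ b * (1 + t) `^ (- c))%:E)%E.
  by rewrite lee_fin mulr_ge0 ?powR_ge0.
have -> : `]0%R, +oo[%classic = `]0%R, (1:R)]%classic `|` `]1%R, +oo[%classic.
  apply/seteqP; split => t /=; rewrite !in_itv/= ?andbT.
    by move=> t0; have [t1|t1] := leP t 1; [left|right]; rewrite ?t0.
  by case=> [/andP[]//|t1]; apply: lt_trans t1.
rewrite ge0_integral_setU//=; last 2 first.
- by apply/measurable_EFinP; exact: measurable_funTS.
- apply/disj_setPS => t /= []; rewrite !in_itv/= andbT => /andP[_ t1] t1'.
  by move: t1; rewrite leNgt t1'.
apply: lte_add_pinfty.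
  apply: le_lt_trans (integral_powR_near0 b1).
  apply: ge0_le_integral => //.
  - by apply/measurable_EFinP; exact: measurable_funTS.
  - by apply/measurable_EFinP/measurable_funTS; exact: measurable_powR.
  - move=> t /=; rewrite in_itv/= => /andP[t0 t1]; rewrite lee_fin.
    rewrite ler_piMr ?powR_ge0// -[leRHS](powRr0 (1 + t)) ler_powR//; lra.
apply: le_lt_trans (integral_powR_nearoo bc).
apply: (@le_trans _ _ (\int[mu]_(t in `]1%R, +oo[) (t `^ (b - c))%:E)%E).
  apply: ge0_le_integral => //.
  - by apply/measurable_EFinP; exact: measurable_funTS.
  - by apply/measurable_EFinP/measurable_funTS; exact: measurable_powR.
  - move=> t /=; rewrite in_itv/= andbT => t1; rewrite lee_fin.
    rewrite powRD; last by apply/implyP => _; rewrite gt_eqF//; lra.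
    rewrite ler_wpM2l ?powR_ge0// !powRN lef_pV2 ?posrE ?powR_gt0//; try lra.
    by rewrite ge0_ler_powR// ?nnegrE; lra.
apply: ge0_subset_integral => //.
- by apply/measurable_EFinP/measurable_funTS; exact: measurable_powR.
- by move=> t _; rewrite lee_fin powR_ge0.
- by move=> t /=; rewrite !in_itv/= !andbT; exact: ltW.
Qed.

Lemma integral_powR_abs_lty (c : R) : 1 < c ->
  (\int[mu]_t ((1 + `|t|) `^ (- c))%:E < +oo)%E.
Proof.
move=> c1.
have mh : measurable_fun [set: R] (fun t : R => (1 + `|t|) `^ (- c)).
  apply: (measurableT_comp (measurable_powR _)).
  by apply: measurable_funD => //; exact: measurable_normr.
have h0 (t : R) : (0 <= ((1 + `|t|) `^ (- c))%:E)%E by rewrite lee_fin powR_ge0.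
rewrite -(setUv `[0%R, +oo[%classic) ge0_integral_setU//=; first last.
- by apply/disj_setPS => t /= [].
- by apply/measurable_EFinP; exact: measurable_funTS.
- exact: measurableC.
have I : (\int[mu]_(t in `[0%R, +oo[) ((1 + `|t|) `^ (- c))%:E < +oo)%E.
  rewrite -integral_itv_obnd_cbnd; last first.
    by apply/measurable_EFinP; exact: measurable_funTS.
  have H : (\int[mu]_(t in `]0%R, +oo[) (t `^ 0 * (1 + t) `^ (- c))%:E < +oo)%E.
    by apply: integral_powR_mul_lty; lra.
  apply: le_lt_trans H; rewrite le_eqVlt; apply/orP; left; apply/eqP.
  apply: eq_integral => t; rewrite inE/= in_itv/= andbT => t0.
  by rewrite powRr0 mul1r gtr0_norm.
apply: lte_add_pinfty => //.
apply: le_lt_trans I.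
rewrite ge0_integration_by_substitution0//; last exact/measurable_EFinP.
rewrite setCitvr.
under [leRHS]eq_integral do rewrite normrN.
apply: ge0_subset_integral => //.
  by apply/measurable_EFinP; exact: measurable_funTS.
by move=> t /=; rewrite !in_itv/=; exact: ltW.
Qed.

End one_dimensional_integrals.

(** * Integration over tuples and affine maps *)

Section integration_on_tuples.
Context (R : realType).
Notation mu := (@lebesgue_measure R).
Notation lam := (lebesgue_tuple R).

Lemma integral_tupleS m (h : Rn R m.+1 -> \bar R) :
  measurable_fun [set: Rn R m.+1] h -> (forall x, (0 <= h x)%E) ->
  (\int[lam m.+1]_x h x =
   \int[mu]_t \int[lam m]_y h (tuple_of_pair (t, y)))%E.
Proof.
move=> mh h0 /=; rewrite /lebesgue_succ.
rewrite (ge0_integral_pushforward (@measurable_tuple_of_pair R m))//.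
rewrite preimage_setT fubini_tonelli1//=.
exact: (measurableT_comp mh (@measurable_tuple_of_pair R m)).
Qed.

Lemma measurable_tnth_R m (i : 'I_m) :
  measurable_fun [set: Rn R m] (fun x => tnth x i : R).
Proof. exact: measurable_tnth. Qed.

(** Every multi-dimensional majorant used below is itself bounded by a product
    over the coordinates, so this is all that is needed to integrate it. *)
Lemma integral_tuple_prod_lty m (phi : 'I_m -> R -> R) :
  (forall i, measurable_fun [set: R] (phi i)) -> (forall i t, 0 <= phi i t) ->
  (forall i, (\int[mu]_t (phi i t)%:E < +oo)%E) ->
  (\int[lam m]_x (\prod_(i < m) phi i (tnth x i))%:E < +oo)%E.
Proof.
elim: m phi => [|m IH] phi mphi phi0 phioo.
  under eq_integral do rewrite big_ord0.
  by rewrite integral_cst//= diracE in_setT mule1 ltry.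
have mP k (psi : 'I_k -> R -> R) : (forall i, measurable_fun [set: R] (psi i)) ->
    measurable_fun [set: Rn R k] (fun x => (\prod_(i < k) psi i (tnth x i))).
  move=> mpsi; apply: measurable_prod => i _.
  by apply: (measurableT_comp (mpsi i)); exact: measurable_tnth_R.
rewrite integral_tupleS; last 2 first.
- by apply/measurable_EFinP; exact: mP.
- by move=> x; rewrite lee_fin prodr_ge0.
pose I := (\int[lam m]_y (\prod_(i < m) phi (lift ord0 i) (tnth y i))%:E)%E.
have I0 : (0 <= I)%E by apply: integral_ge0 => y _; rewrite lee_fin prodr_ge0.
have Ioo : (I < +oo)%E by exact: (IH (fun i => phi (lift ord0 i))).
rewrite (_ : (\int[mu]_t _ = \int[mu]_t ((phi ord0 t)%:E * I))%E); last first.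
  apply: eq_integral => t _; rewrite -ge0_integralZl//; first last.
  - by rewrite lee_fin.
  - by move=> y _; rewrite lee_fin prodr_ge0.
  - by apply/measurable_EFinP; apply: (mP m (fun i => phi (lift ord0 i))) => i; exact: mphi.
  apply: eq_integral => y _; rewrite big_ord_recl -EFinM; congr (_ * _)%:E.
  by apply: eq_bigr => i _; rewrite tnthS.
rewrite ge0_integralZr//; last 2 first.
- by apply/measurable_EFinP; exact: mphi.
- by move=> t _; rewrite lee_fin.
apply: lte_mul_pinfty => //; first by apply: integral_ge0 => t _; rewrite lee_fin.
by rewrite ge0_fin_numE//; apply: integral_ge0 => t _; rewrite lee_fin.
Qed.

Definition affine_tuple m (a : Rn R m) (r : R) (x : Rn R m) : Rn R m :=
  [tuple (tnth a i : R) + r * tnth x i | i < m].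

Lemma measurable_affine_tuple m (a : Rn R m) (r : R) :
  measurable_fun [set: Rn R m] (affine_tuple a r).
Proof.
apply/measurable_fun_tnthP => i.
rewrite (_ : _ \o _ = (fun x : Rn R m => (tnth a i : R) + r * tnth x i)).
  apply: measurable_funD => //; apply: measurable_funM => //.
  exact: measurable_tnth_R.
by apply/funext => x; rewrite /= tnth_mktuple.
Qed.

(** Both sides are measures in [A]; by uniqueness of the Lebesgue measure it is
    enough to compare them on half-open intervals. *)
Lemma lebesgue_measure_affine (a r : R) (A : set (measurableTypeR R)) :
  0 < r -> measurable A ->
  (r%:E * pushforward mu (fun t : measurableTypeR R => (a + r * t)%R : measurableTypeR R) A = mu A)%E.
Proof.
move=> r0 mA.
pose phi (t : measurableTypeR R) : measurableTypeR R := a + r * t.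
have mphi : measurable_fun [set: measurableTypeR R] phi.
  by apply: measurable_funD => //; exact: measurable_funM.
pose nu0 : {measure set (measurableTypeR R) -> \bar R} :=
  mscale (NngNum (ltW r0)) (pushforward mu phi).
pose nu := nu0 mphi.
apply/esym; apply: (@lebesgue_measure_unique R nu) => //= _ [[x y]] _ <-.
rewrite /nu /nu0 /= /mscale/= /pushforward.
have -> : phi @^-1` `](x, y).1, (x, y).2] = `](x - a) / r, (y - a) / r]%classic.
  apply/seteqP; split => t /=; rewrite /phi !in_itv/= ltr_pdivrMr// ler_pdivlMr// => /andP[h1 h2];
    apply/andP; split; lra.
rewrite !lebesgue_measure_itv/= !lte_fin ltr_pM2r ?invr_gt0// ltrD2r.
case: ifPn => _; last by rewrite mule0.
rewrite -EFinB -EFinM; congr (_%:E); field; exact/lt0r_neq0.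
Qed.

Lemma integral_affine (a r : R) (h : R -> \bar R) :
  0 < r -> measurable_fun [set: R] h -> (forall x, (0 <= h x)%E) ->
  (\int[mu]_t h (a + r * t)%R = r^-1%:E * \int[mu]_t h t)%E.
Proof.
move=> r0 mh h0.
pose phi (t : measurableTypeR R) : measurableTypeR R := a + r * t.
have mphi : measurable_fun [set: measurableTypeR R] phi.
  by apply: measurable_funD => //; exact: measurable_funM.
have mphi' : measurable_fun [set: R] phi by [].
pose rn := NngNum (ltW r0).
pose nu0 : {measure set (measurableTypeR R) -> \bar R} := mscale rn (pushforward mu phi).
pose nu := nu0 mphi.
have -> : (\int[mu]_t h t = \int[nu]_t h t)%E.
  apply: (@eq_measure_integral _ _ _ setT nu mu) => A mA _.
  exact/esym/(lebesgue_measure_affine a r0 mA).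
rewrite /nu /nu0 ge0_integral_mscale//= ge0_integral_pushforward//.
by rewrite muleA -EFinM mulVf ?gt_eqF// mul1e preimage_setT.
Qed.

Lemma integral_affine_tuple m (a : Rn R m) (r : R) (h : Rn R m -> \bar R) :
  0 < r -> measurable_fun [set: Rn R m] h -> (forall x, (0 <= h x)%E) ->
  (\int[lam m]_x h (affine_tuple a r x) = (r ^- m)%:E * \int[lam m]_x h x)%E.
Proof.
move=> r0; elim: m a h => [|m IH] a h mh h0.
  rewrite expr0 invr1 mul1e; apply: eq_integral => x _; congr h.
  by rewrite [RHS]tuple0 [LHS]tuple0.
rewrite integral_tupleS//; last first.
  exact: (measurableT_comp mh (measurable_affine_tuple a r)).
pose a' : Rn R m := [tuple tnth a (lift ord0 i) | i < m].
have E t y : affine_tuple a r (tuple_of_pair (t, y)) =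
    tuple_of_pair ((tnth a ord0 : R) + r * t, affine_tuple a' r y).
  apply: eq_from_tnth => i; rewrite tnth_mktuple.
  have [->//|i0] := eqVneq i ord0.
  have [j ->] : exists j, i = lift ord0 j.
    by case: (unliftP ord0 i) i0 => [j ->|->]; [exists j|rewrite eqxx].
  by rewrite !tnthS/= !tnth_mktuple.
have mh' (t : R) : measurable_fun [set: Rn R m] (fun y => h (tuple_of_pair (t, y))).
  apply: (measurableT_comp mh); apply: (measurableT_comp (@measurable_tuple_of_pair R m)).
  exact: measurable_pair1.
have mF : measurable_fun [set: R] (fun t => \int[lam m]_y h (tuple_of_pair (t, y)))%E.
  apply: (@measurable_fun_fubini_tonelli_F _ _ (measurableTypeR R) (Rn R m) R (lam m)
     (h \o @tuple_of_pair R m)).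
    exact: (measurableT_comp mh (@measurable_tuple_of_pair R m)).
  by move=> x; exact: h0.
transitivity (\int[mu]_t ((r ^- m)%:E *
    \int[lam m]_y h (tuple_of_pair (((tnth a ord0 : R) + r * t)%R, y))))%E.
  apply: eq_integral => t _; under eq_integral do rewrite E.
  by rewrite (IH a' (fun y => h (tuple_of_pair (((tnth a ord0 : R) + r * t), y)))).
rewrite ge0_integralZl//; last 3 first.
- rewrite -[X in measurable_fun _ X]/((fun t => \int[lam m]_y h (tuple_of_pair (t, y)))%E
    \o (fun t : R => (tnth a ord0 : R) + r * t)).
  apply: (measurableT_comp mF).
  by apply: measurable_funD => //; exact: measurable_funM.
- by move=> t _; exact: integral_ge0.
- by rewrite lee_fin invr_ge0 exprn_ge0// ltW.
rewrite (@integral_affine _ r (fun t => \int[lam m]_y h (tuple_of_pair (t, y)))%E)//; last first.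
  by move=> t; exact: integral_ge0.
by rewrite muleA -EFinM -invfM -exprSr -integral_tupleS.
Qed.

End integration_on_tuples.

(** * Euclidean distance and power inequalities *)

Section euclidean_distance.
Context (R : realType).

Lemma sqrt_sum_sqrD (n : nat) (a b : 'I_n -> R) :
  Num.sqrt (\sum_(i < n) (a i + b i) ^+ 2) <=
  Num.sqrt (\sum_(i < n) a i ^+ 2) + Num.sqrt (\sum_(i < n) b i ^+ 2).
Proof.
set A := \sum_(i < n) a i ^+ 2; set B := \sum_(i < n) b i ^+ 2.
have A0 : 0 <= A by apply: sumr_ge0 => i _; exact: sqr_ge0.
have B0 : 0 <= B by apply: sumr_ge0 => i _; exact: sqr_ge0.
set C := \sum_(i < n) a i * b i.
have sA := sqr_sqrtr A0; have sB := sqr_sqrtr B0.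
set x := Num.sqrt A in sA *; set y := Num.sqrt B in sB *.
have x0 : 0 <= x := sqrtr_ge0 A; have y0 : 0 <= y := sqrtr_ge0 B.
have Cxy : C <= x * y.
  have H : 0 <= \sum_(i < n) (y * a i - x * b i) ^+ 2.
    by apply: sumr_ge0 => i _; exact: sqr_ge0.
  have E : \sum_(i < n) (y * a i - x * b i) ^+ 2 = 2 * (x * y) * (x * y - C).
    transitivity (y ^+ 2 * A - 2 * x * y * C + x ^+ 2 * B).
      rewrite /A /B /C !mulr_sumr -sumrB -big_split/=.
      by apply: eq_bigr => i _; ring.
    by rewrite -sA -sB; ring.
  (* the expansion above is void when [x * y = 0], where one of the families is null *)
  have z (f : 'I_n -> R) (g : 'I_n -> R) : \sum_(i < n) f i ^+ 2 = 0 ->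
      \sum_(i < n) f i * g i = 0.
    move=> /eqP; rewrite psumr_eq0 => [/allP f0|i _]; last exact: sqr_ge0.
    apply: big1 => i _; have := f0 i (mem_index_enum i).
    by rewrite sqrf_eq0 => /eqP ->; rewrite mul0r.
  have xy0 : 0 <= x * y by exact: mulr_ge0.
  move: x0; rewrite le_eqVlt => /predU1P[x0|x0].
    rewrite [C](z a b) ?xy0//; apply/eqP.
    by rewrite -[X in X == _]/A -sA -x0 expr0n.
  move: y0; rewrite le_eqVlt => /predU1P[y0|y0].
    rewrite /C; under eq_bigr do rewrite mulrC.
    rewrite (z b a) ?xy0//; apply/eqP.
    by rewrite -[X in X == _]/B -sB -y0 expr0n.
  by move: H; rewrite E pmulr_rge0 ?subr_ge0// !mulr_gt0.
rewrite -[leRHS]ger0_norm ?addr_ge0// -sqrtr_sqr ler_wsqrtr//.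
have -> : \sum_(i < n) (a i + b i) ^+ 2 = A + 2 * C + B.
  by rewrite /A /B /C mulr_sumr -!big_split/=; apply: eq_bigr => i _; ring.
by rewrite -sA -sB; nra.
Qed.

Lemma edist_ge0 n (x z : Rn R n) : 0 <= edist x z.
Proof. exact: sqrtr_ge0. Qed.

Lemma edistC n (x z : Rn R n) : edist x z = edist z x.
Proof. by congr Num.sqrt; apply: eq_bigr => i _; rewrite -sqrrN opprB. Qed.

Lemma edist_triangle n (x y z : Rn R n) : edist x z <= edist x y + edist y z.
Proof.
have := @sqrt_sum_sqrD n (fun i => (tnth x i : R) - tnth y i)
  (fun i => (tnth y i : R) - tnth z i).
apply: le_trans; rewrite le_eqVlt; apply/orP; left; apply/eqP.
congr Num.sqrt; apply: eq_bigr => i _; congr (_ ^+ 2); ring.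
Qed.

Lemma le_edist_tnth n (x z : Rn R n) (i : 'I_n) :
  `|(tnth x i : R) - tnth z i| <= edist x z.
Proof.
rewrite -sqrtr_sqr ler_wsqrtr// (bigD1 i)//= lerDl.
by apply: sumr_ge0 => j _; exact: sqr_ge0.
Qed.

Lemma edist_le_sum n (x z : Rn R n) :
  edist x z <= \sum_(i < n) `|(tnth x i : R) - tnth z i|.
Proof.
have S0 (s : seq 'I_n) : 0 <= \sum_(i <- s) `|(tnth x i : R) - tnth z i|.
  by apply: sumr_ge0 => i _.
rewrite -[leRHS]ger0_norm ?S0// -sqrtr_sqr ler_wsqrtr//.
elim: (index_enum _) => [|i s IH]; first by rewrite !big_nil expr0n.
rewrite !big_cons; set t := \sum_(i <- s) `|_| in IH *.
have t0 : 0 <= t by exact: S0.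
rewrite -[X in X + _]real_normK ?num_real//.
have := normr_ge0 ((tnth x i : R) - tnth z i); nra.
Qed.

Lemma edist_affine_tuple n (a : Rn R n) (r : R) (x z : Rn R n) : 0 <= r ->
  edist (affine_tuple a r x) (affine_tuple a r z) = r * edist x z.
Proof.
move=> r0; rewrite /edist.
rewrite (eq_bigr (fun i => r ^+ 2 * ((tnth x i : R) - tnth z i) ^+ 2)).
by rewrite -mulr_sumr sqrtrM ?sqr_ge0// sqrtr_sqr ger0_norm.
by move=> i _; rewrite !tnth_mktuple -exprMn; congr (_ ^+ 2); ring.
Qed.

Lemma measurable_edist d (T : measurableType d) n (f g : T -> Rn R n) :
  measurable_fun [set: T] f -> measurable_fun [set: T] g ->
  measurable_fun [set: T] (fun t => edist (f t) (g t)).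
Proof.
move=> mf mg.
have -> : (fun t => edist (f t) (g t)) =
   (fun t => (\sum_(i < n) ((tnth (f t) i : R) - tnth (g t) i) ^+ 2) `^ 2^-1).
  apply/funext => t; rewrite powR12_sqrt//.
  by apply: sumr_ge0 => i _; exact: sqr_ge0.
apply: (measurableT_comp (measurable_powR _)).
apply: measurable_sum => i; apply: measurable_funX; apply: measurable_funB.
  exact: (measurableT_comp (@measurable_tnth_R R n i) mf).
exact: (measurableT_comp (@measurable_tnth_R R n i) mg).
Qed.

Definition origin n : Rn R n := [tuple (0 : R) | i < n].

Notation bd m := (@boundary_point R m.+1).

Lemma ord_widen_or_max m (i : 'I_m.+1) :
  (exists j, i = widen_ord (leqnSn m) j) \/ i = ord_max.
Proof.
have [im|im] := ltnP i m; first by left; exists (Ordinal im); exact/val_inj.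
by right; apply/val_inj/eqP; rewrite /= eqn_leq im -ltnS ltn_ord.
Qed.

Lemma tnth_boundary_widen m (y : Rn R m) (i : 'I_m) :
  tnth (bd m y) (widen_ord (leqnSn m) i) = tnth y i.
Proof. by rewrite tnth_mktuple/= ltn_ord (tnth_nth 0). Qed.

Lemma tnth_boundary_max m (y : Rn R m) : tnth (bd m y) ord_max = 0.
Proof. by rewrite tnth_mktuple/= ltnn. Qed.

Lemma boundary_point_affine m (a : Rn R m) (r : R) (y : Rn R m) :
  affine_tuple (bd m a) r (bd m y) = bd m (affine_tuple a r y).
Proof.
apply: eq_from_tnth => i; rewrite tnth_mktuple.
have [[j ->]|->] := ord_widen_or_max i.
  by rewrite !tnth_boundary_widen tnth_mktuple.
by rewrite !tnth_boundary_max mulr0 addr0.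
Qed.

Lemma edist_boundary_point m (y z : Rn R m) : edist (bd m y) (bd m z) = edist y z.
Proof.
rewrite /edist big_ord_recr/= !tnth_boundary_max subrr expr0n addr0.
by congr Num.sqrt; apply: eq_bigr => i _; rewrite !tnth_boundary_widen.
Qed.

Lemma measurable_boundary_point m : measurable_fun [set: Rn R m] (bd m).
Proof.
apply/measurable_fun_tnthP => i.
have [[j ->]|->] := ord_widen_or_max i.
  rewrite (_ : _ \o _ = fun y : Rn R m => tnth y j); first exact: measurable_tnth.
  by apply/funext => y/=; rewrite tnth_boundary_widen.
rewrite (_ : _ \o _ = cst 0); first exact: measurable_cst.
by apply/funext => y/=; rewrite tnth_boundary_max.
Qed.

Lemma nth_last_tnth m (x : Rn R m.+1) : (x`_m : R) = tnth x ord_max.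
Proof. by rewrite (tnth_nth 0). Qed.

Lemma le_last_edist_boundary m (x : Rn R m.+1) (y : Rn R m) :
  (x`_m : R) <= edist x (bd m y).
Proof.
apply: le_trans (le_edist_tnth x (bd m y) ord_max).
by rewrite tnth_boundary_max subr0 nth_last_tnth ler_norm.
Qed.

Lemma boundary_point_origin m : bd m (origin m) = origin m.+1.
Proof.
apply: eq_from_tnth => i; rewrite !tnth_mktuple; case: ifPn => // im.
by rewrite -[i : nat]/(val (Ordinal im)) -tnth_nth tnth_mktuple.
Qed.

End euclidean_distance.

Section power_inequalities.
Context (R : realType).

Lemma powR_antitone (s x y : R) : s <= 0 -> 0 < x -> x <= y ->
  y `^ s <= x `^ s.
Proof.
move=> s0 x0 xy; have y0 := lt_le_trans x0 xy.
have E (z : R) : z `^ s = (z `^ (- s))^-1 by rewrite -powRN opprK.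
rewrite !E lef_pV2 ?posrE ?powR_gt0//.
by apply: ge0_ler_powR => //; rewrite ?nnegrE ?oppr_ge0// ltW.
Qed.

(** A substitute for subadditivity ([lam <= 1]) and convexity ([lam >= 1]) that
    treats all exponents alike: according to whether [t <= eta * s] one of the two
    terms alone dominates. For small [eta] the coefficient of [s `^ lam] is close
    to [1], which is what makes potentials equicontinuous; [eta = 1] gives the
    crude doubling inequality below. *)
Lemma powRD_le (lam eta s t : R) : 0 <= lam -> 0 < eta -> 0 <= s -> 0 <= t ->
  (s + t) `^ lam <= (1 + eta) `^ lam * s `^ lam + (1 + eta^-1) `^ lam * t `^ lam.
Proof.
move=> l0 e0 s0 t0; have ie0 : 0 < eta^-1 by rewrite invr_gt0.
rewrite -!powRM ?addr_ge0 ?ler01 ?(ltW e0) ?(ltW ie0)//.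
have [ts|ts] := leP t (eta * s).
  apply: ler_wpDr; first exact: powR_ge0.
  apply: ge0_ler_powR => //; rewrite ?nnegrE ?addr_ge0// ?mulr_ge0 ?addr_ge0 ?(ltW e0)//.
  by rewrite mulrDl mul1r lerD2l.
apply: ler_wpDl; first exact: powR_ge0.
have /ltW st : s < eta^-1 * t by rewrite ltr_pdivlMl.
apply: ge0_ler_powR => //; rewrite ?nnegrE ?addr_ge0// ?mulr_ge0 ?addr_ge0 ?(ltW ie0)//.
by rewrite mulrDl mul1r addrC lerD2l.
Qed.

Lemma powRD_le2 (lam s t : R) : 0 <= lam -> 0 <= s -> 0 <= t ->
  (s + t) `^ lam <= 2 `^ lam * (s `^ lam + t `^ lam).
Proof.
move=> l0 s0 t0; have := powRD_le l0 ltr01 s0 t0.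
by rewrite invr1 mulrDr.
Qed.

Lemma powR_weighted_AGM (theta a b : R) : 0 < theta < 1 -> 0 <= a -> 0 <= b ->
  a `^ theta * b `^ (1 - theta) <= theta * a + (1 - theta) * b.
Proof.
move=> /andP[t0 t1] a0 b0; have t1' : 0 < 1 - theta by lra.
have := @conjugate_powR _ (a `^ theta) (b `^ (1 - theta)) theta^-1 (1 - theta)^-1
  (powR_ge0 _ _) (powR_ge0 _ _).
rewrite !invr_gt0 !invrK -!powRrM !mulfV ?gt_eqF// !powRr1// => /(_ t0 t1').
by rewrite mulrC (mulrC a) (mulrC b) mulrC; apply; ring.
Qed.

End power_inequalities.

(** * Integrability of power weights *)

Section decay_integrals.
Context (R : realType).
Notation mu := (@lebesgue_measure R).
Notation lam := (lebesgue_tuple R).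

(** Since [1 + |x|] dominates each [1 + |x_i|], a total decay exponent may be
    distributed among the coordinates in any way. *)
Lemma powR_norm_le_prod n (t : 'I_n -> R) (x : Rn R n) : (forall i, 0 <= t i) ->
  (1 + edist x (origin R n)) `^ (- \sum_(i < n) t i) <=
  \prod_(i < n) (1 + `|tnth x i : R|) `^ (- t i).
Proof.
move=> t0; have e0 := edist_ge0 x (origin R n).
have -> : - \sum_(i < n) t i = \sum_(i < n) - t i by rewrite sumrN.
have -> : (1 + edist x (origin R n)) `^ (\sum_(i < n) - t i) =
    \prod_(i < n) (1 + edist x (origin R n)) `^ (- t i).
  elim/big_rec2 : _ => [|i y1 y2 _ <-]; first by rewrite powRr0.
  by rewrite powRD//; apply/implyP => _; rewrite gt_eqF//; lra.
apply: ler_prod => i _; rewrite powR_ge0/= !powRN.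
have a0 : 0 <= `|tnth x i : R| by [].
rewrite lef_pV2 ?posrE ?powR_gt0//; try lra.
apply: ge0_ler_powR => //; rewrite ?nnegrE; try lra.
rewrite lerD2l; apply: le_trans (le_edist_tnth x (origin R n) i).
by rewrite tnth_mktuple subr0.
Qed.

Lemma measurable_norm n : measurable_fun [set: Rn R n] (fun x => edist x (origin R n)).
Proof. by apply: measurable_edist => //; exact: measurable_cst. Qed.

Lemma measurable_powR_norm n s :
  measurable_fun [set: Rn R n] (fun x => (1 + edist x (origin R n)) `^ s).
Proof.
apply: (measurableT_comp (measurable_powR _)).
by apply: measurable_funD => //; exact: measurable_norm.
Qed.

Lemma integral_norm_powR_lty m (s : R) : (0 < m)%N -> m%:R < s ->
  (\int[lam m]_y ((1 + edist y (origin R m)) `^ (- s))%:E < +oo)%E.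
Proof.
move=> m0 ms; have m0R : 0 < m%:R :> R by rewrite ltr0n.
have sm : 1 < s / m%:R by rewrite ltr_pdivlMr// mul1r.
pose phi (i : 'I_m) (t : R) := (1 + `|t|) `^ (- (s / m%:R)).
have mphi i : measurable_fun [set: R] (phi i).
  apply: (measurableT_comp (measurable_powR _)).
  by apply: measurable_funD => //; exact: measurable_normr.
apply: (@le_lt_trans _ _ (\int[lam m]_x (\prod_(i < m) phi i (tnth x i))%:E)%E).
  apply: ge0_le_integral => //.
  - by move=> y _; rewrite lee_fin powR_ge0.
  - by apply/measurable_EFinP; exact: measurable_powR_norm.
  - apply/measurable_EFinP; apply: measurable_prod => i _.
    by apply: (measurableT_comp (mphi i)); exact: measurable_tnth_R.
  - move=> y _; rewrite lee_fin.
    have -> : - s = - \sum_(i < m) (s / m%:R).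
      by rewrite sumr_const card_ord -(mulr_natr (s / m%:R)) mulfVK// gt_eqF.
    by apply: powR_norm_le_prod => i; lra.
apply: integral_tuple_prod_lty => //.
- by move=> i t; exact: powR_ge0.
- by move=> i; exact: integral_powR_abs_lty.
Qed.

Lemma measurable_half_space n : measurable (half_space R n.+1).
Proof.
rewrite (_ : half_space R n.+1 = (fun x : Rn R n.+1 => tnth x ord_max : R) @^-1` `]0%R, +oo[).
  by rewrite -[X in measurable X]setTI; apply: (@measurable_tnth_R R n.+1 ord_max).
by apply/seteqP; split => x /=; rewrite /half_space/= in_itv/= andbT nth_last_tnth.
Qed.

(** The decay [tau] is shared out: each tangential variable gets [1 + e], the
    normal one [1 + e + b], where the extra [b] pays for the factor [x_n `^ b] at
    infinity. That [e] can be taken positive is exactly [n + b < tau]. *)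
Lemma integral_half_space_powR_lty m (b tau : R) :
  -1 < b -> b <= 0 -> m.+1%:R + b < tau ->
  (\int[lam m.+1]_(x in half_space R m.+1)
    ((x`_m : R) `^ b * (1 + edist x (origin R m.+1)) `^ (- tau))%:E < +oo)%E.
Proof.
move=> b1 b0 mt.
pose e := (tau - b) / m.+1%:R - 1.
have e0 : 0 < e by rewrite /e subr_gt0 ltr_pdivlMr// mul1r; lra.
pose t (i : 'I_m.+1) : R := 1 + e + (if i == ord_max then b else 0).
have t0 i : 0 <= t i by rewrite /t; case: ifP => _; lra.
have tE : tau = \sum_(i < m.+1) t i.
  rewrite /t big_split/= sumr_const -big_mkcond/= big_pred1_eq.
  by rewrite card_ord -(mulr_natr (1 + e)) /e subrKC mulfVK ?subrK//.
pose phi (i : 'I_m.+1) (u : R) := (1 + `|u|) `^ (- t i) *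
  (if i == ord_max then (u `^ b * \1_(`]0%R, +oo[%classic : set R) u) else 1).
have phi0 i u : 0 <= phi i u.
  by rewrite /phi mulr_ge0 ?powR_ge0//; case: ifP => // _; rewrite mulr_ge0 ?powR_ge0.
have mphi i : measurable_fun [set: R] (phi i).
  apply: measurable_funM.
    apply: (measurableT_comp (measurable_powR _)).
    by apply: measurable_funD => //; exact: measurable_normr.
  case: (i == ord_max) => //.
  by apply: measurable_funM; [exact: measurable_powR|exact: measurable_indic].
rewrite integral_mkcond.
apply: (@le_lt_trans _ _ (\int[lam m.+1]_x (\prod_(i < m.+1) phi i (tnth x i))%:E)%E).
  apply: ge0_le_integral => //.
  - by move=> x _; apply: erestrict_ge0 => y _; rewrite lee_fin mulr_ge0 ?powR_ge0.
  - apply/(measurable_restrictT _ _).1; first exact: measurable_half_space.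
    apply/measurable_EFinP/measurable_funTS; apply: measurable_funM.
      rewrite (_ : (fun x : Rn R m.+1 => _) = (fun x : Rn R m.+1 => (tnth x ord_max : R) `^ b)).
        by apply: (measurableT_comp (measurable_powR _)); exact: measurable_tnth_R.
      by apply/funext => x; rewrite nth_last_tnth.
    exact: measurable_powR_norm.
  - apply/measurable_EFinP; apply: measurable_prod => i _.
    by apply: (measurableT_comp (mphi i)); exact: measurable_tnth_R.
  - move=> x _; rewrite patchE; case: ifPn => xH; last first.
      by rewrite lee_fin prodr_ge0.
    rewrite lee_fin /phi big_split/= mulrC -big_mkcond/= big_pred1_eq tE.
    move: xH; rewrite inE /half_space/= nth_last_tnth => x0.
    rewrite indicE mem_set ?mulr1//=; last by rewrite in_itv/= x0.
    by rewrite ler_wpM2r ?powR_ge0// powR_norm_le_prod.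
apply: integral_tuple_prod_lty => // i.
rewrite /phi; have [->|im] := eqVneq i ord_max; last first.
  under eq_integral do rewrite mulr1.
  by apply: integral_powR_abs_lty; rewrite /t (negbTE im); lra.
rewrite (_ : (\int[mu]__ _)%E =
    \int[mu]_(u in `]0%R, +oo[) (u `^ b * (1 + u) `^ (- (1 + e + b)))%:E)%E.
  by apply: integral_powR_mul_lty; lra.
rewrite [RHS]integral_mkcond; apply: eq_integral => u _.
rewrite patchE indicE; case: ifPn => [|_]; last by rewrite !mulr0.
by rewrite inE/= in_itv/= andbT => u0; rewrite mulr1 gtr0_norm// mulrC /t eqxx.
Qed.

End decay_integrals.

(** * Powers with negative exponents and the improvement step *)

Section extended_powers.
Context (R : realType).

Lemma epow_ge0 (x : \bar R) s : (0 <= epow x s)%E.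
Proof.
rewrite /epow; case: (s < 0)%R; last exact: poweR_ge0.
case: (x == 0%E) => //; case: (x == +oo%E) => //; exact: poweR_ge0.
Qed.

Lemma epow_EFin (x s : R) : 0 < x -> epow x%:E s = (x `^ s)%:E.
Proof. by move=> x0; rewrite /epow; case: ifPn => // _; rewrite eqe gt_eqF. Qed.

Lemma epow_pos (x : \bar R) s : 0 < s -> epow x s = (x `^ s)%E.
Proof. by move=> s0; rewrite /epow ltNge (ltW s0). Qed.

Lemma measurable_epow s : measurable_fun [set: \bar R] (fun x => epow x s).
Proof.
rewrite /epow; case: (s < 0); last exact: measurable_poweR.
apply: measurable_fun_ifT => //=; first exact: measurable_fun_eqe.
apply: measurable_fun_ifT => //=; first exact: measurable_fun_eqe.
exact: measurable_poweR.
Qed.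

Lemma epow_le_neg (x y : \bar R) s : s < 0 -> (0 <= x)%E -> (x <= y)%E ->
  (epow y s <= epow x s)%E.
Proof.
move=> s0 x0 xy; have y0 := le_trans x0 xy; rewrite /epow s0.
move: x0; rewrite le_eqVlt => /predU1P[<-|x0]; first by rewrite eqxx leey.
have y0' := lt_le_trans x0 xy; rewrite (gt_eqF x0) (gt_eqF y0').
clear y0; case: x y xy x0 y0' => [x| |] [y| |]//=; first last.
- by move=> _ _ _; rewrite lee_fin powR_ge0.
rewrite !lte_fin lee_fin => xy x0 y0; rewrite lee_fin.
exact: powR_antitone (ltW s0) x0 xy.
Qed.

End extended_powers.

Section improvement.
Context d1 d2 (X : measurableType d1) (Y : measurableType d2) (R : realType).
Variables (mu : {sigma_finite_measure set X -> \bar R}).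
Variables (nu : {sigma_finite_measure set Y -> \bar R}).
Variable K : X -> Y -> R.
Hypothesis mK : measurable_fun [set: X * Y] (fun z => K z.1 z.2).
Hypothesis K0 : forall x y, 0 <= K x y.

Definition transform (f : Y -> R) (x : X) : \bar R := (\int[nu]_y (K x y * f y)%:E)%E.

Lemma measurable_transform_kernel (f : Y -> R) (g : X -> R) :
  measurable_fun [set: Y] f -> measurable_fun [set: X] g ->
  measurable_fun [set: X * Y] (fun z => (g z.1 * (K z.1 z.2 * f z.2))%:E).
Proof.
move=> mf mg; apply/measurable_EFinP; apply: measurable_funM.
  exact: (measurableT_comp mg).
by apply: measurable_funM => //; exact: (measurableT_comp mf).
Qed.

Lemma measurable_kernel_section x : measurable_fun [set: Y] (K x).
Proof. by apply: (@measurableT_comp _ _ _ _ _ _ (fun z : X * Y => K z.1 z.2) _ (pair x) mK); exact: measurable_pair1. Qed.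

Lemma measurable_kernel_section2 y : measurable_fun [set: X] (K ^~ y).
Proof. by apply: (@measurableT_comp _ _ _ _ _ _ (fun z : X * Y => K z.1 z.2) _ (fun x => (x, y)) mK); exact: measurable_pair2. Qed.

Lemma measurable_transform (f : Y -> R) :
  measurable_fun [set: Y] f -> (forall y, 0 <= f y) ->
  measurable_fun [set: X] (transform f).
Proof.
move=> mf f0; have mh := measurable_transform_kernel mf (@measurable_cst _ _ X R setT 1).
apply: (eq_measurable_fun (fun x => \int[nu]_y (1 * (K x y * f y))%:E)%E).
  by move=> x _; apply: eq_integral => y _; rewrite mul1r.
apply: (measurable_fun_fubini_tonelli_F (fun z => (1 * (K z.1 z.2 * f z.2))%:E)) => // z.
by rewrite lee_fin !mulr_ge0.
Qed.

Lemma transform_ge0 (f : Y -> R) : (forall y, 0 <= f y) -> forall x, (0 <= transform f x)%E.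
Proof. by move=> f0 x; apply: integral_ge0 => y _; rewrite lee_fin mulr_ge0. Qed.

(** Tonelli: the transform and its transpose are dual for the integral pairing. *)
Lemma transform_duality (f : Y -> R) (g : X -> R) :
  measurable_fun [set: Y] f -> measurable_fun [set: X] g ->
  (forall y, 0 <= f y) -> (forall x, 0 <= g x) ->
  (\int[mu]_x ((g x)%:E * transform f x) =
   \int[nu]_y ((f y)%:E * \int[mu]_x (K x y * g x)%:E))%E.
Proof.
move=> mf mg f0 g0.
transitivity (\int[mu]_x \int[nu]_y (g x * (K x y * f y))%:E)%E.
  apply: eq_integral => x _; rewrite /transform -ge0_integralZl//; last 3 first.
  - apply/measurable_EFinP; apply: measurable_funM => //; exact: measurable_kernel_section.
  - by move=> y _; rewrite lee_fin mulr_ge0.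
  - by rewrite lee_fin.
rewrite (fubini_tonelli (fun z => (g z.1 * (K z.1 z.2 * f z.2))%:E))/=; last 2 first.
- exact: measurable_transform_kernel.
- by move=> z; rewrite lee_fin !mulr_ge0.
apply: eq_integral => y _; rewrite -ge0_integralZl//; last 3 first.
- apply/measurable_EFinP; apply: measurable_funM => //; exact: measurable_kernel_section2.
- by move=> x _; rewrite lee_fin mulr_ge0.
- by rewrite lee_fin.
by apply: eq_integral => x _; rewrite -EFinM; congr (_%:E); ring.
Qed.

(** One step of the alternating optimization attached to the bilinear form
    [\int \int K(x,y) f(y) g(x)]: freeze [g = (T f) `^ (q - 1)] on [A], let [u] be
    the transpose transform of [g], and replace [f] by the normalized minimizer
    [ft] of the linear functional [h |-> \int u h], which is a multiple of
    [u `^ (- 1 / (1 - p))]. The weighted AM-GM inequality with weight [p] says that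
    [ft] indeed does not increase this functional,
    [\int u ft <= \int u f = \int_A (T f) `^ q]; the same inequality with weight
    [1 / (1 - q)] says that [t |-> t `^ q] lies above its tangents, so that a smaller
    pairing with [g] means a larger [\int_A (T ft) `^ q]. Restricting to [A] keeps
    every quantity finite. *)
Lemma transform_improvement (p q sigma : R) (f : Y -> R) (u : Y -> R)
    (A : set X) (b : X -> R) :
  0 < p < 1 -> q < 0 -> 0 < sigma ->
  measurable_fun [set: Y] f -> (forall y, 0 <= f y) ->
  (\int[nu]_y ((f y) `^ p)%:E = 1)%E ->
  measurable A -> measurable_fun [set: X] b ->
  (forall x, A x -> 0 < b x) -> (forall x, A x -> transform f x = (b x)%:E) ->
  (\int[mu]_(x in A) ((b x) `^ q)%:E < +oo)%E ->
  measurable_fun [set: Y] u -> (forall y, 0 < u y) ->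
  (forall y, \int[mu]_x (K x y * (b x `^ (q - 1) * \1_A x))%:E = (u y)%:E)%E ->
  let ft y := sigma * u y `^ (- (1 - p)^-1) in
  (\int[nu]_y ((ft y) `^ p)%:E = 1)%E ->
  (\int[mu]_(x in A) ((b x) `^ q)%:E <= \int[mu]_(x in A) epow (transform ft x) q)%E.
Proof.
move=> /andP[p0 p1] q0 s0 mf f0 fp mA mb b0 bT Ioo mu_ u0 uE ft ftp.
have p1' : 0 < 1 - p by lra.
have p1n : 1 - p != 0 by rewrite gt_eqF.
set gam := (1 - p)^-1 in ft ftp *.
have ft0 y : 0 < ft y by rewrite mulr_gt0 ?powR_gt0.
have mft : measurable_fun [set: Y] ft.
  by apply: measurable_funM => //; apply: (measurableT_comp (measurable_powR _)).
have mpow (h : Y -> R) s : measurable_fun [set: Y] h ->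
    measurable_fun [set: Y] (fun y => (h y `^ s)%:E).
  by move=> mh; apply/measurable_EFinP; apply: (measurableT_comp (measurable_powR _)).
pose g x := b x `^ (q - 1) * \1_A x.
have mg : measurable_fun [set: X] g.
  apply: measurable_funM; last exact: measurable_indic.
  exact: (measurableT_comp (measurable_powR _)).
have g0 x : 0 <= g x by rewrite mulr_ge0 ?powR_ge0.
set IA := (\int[mu]_(x in A) _)%E in Ioo *.
have IA0 : (0 <= IA)%E by apply: integral_ge0 => x _; rewrite lee_fin powR_ge0.
have duality (h : Y -> R) : measurable_fun [set: Y] h -> (forall y, 0 <= h y) ->
    (\int[nu]_y (h y * u y)%:E =
     \int[mu]_(x in A) ((b x `^ (q - 1))%:E * transform h x))%E.
  move=> mh h0; transitivity (\int[mu]_x ((g x)%:E * transform h x))%E.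
    rewrite transform_duality//; apply: eq_integral => y _.
    by rewrite EFinM -uE.
  rewrite [RHS]integral_mkcond; apply: eq_integral => x _.
  by rewrite patchE /g indicE; case: (x \in A); rewrite ?mulr1// mulr0 mul0e.
have uf : (\int[nu]_y (f y * u y)%:E = IA)%E.
  rewrite duality//; apply: eq_integral => x /[1!inE] Ax.
  rewrite bT// -EFinM; congr (_%:E).
  by rewrite -{2}[b x]powRr1 ?(ltW (b0 _ Ax))// -powRD ?subrK// lt_eqF.
have uft : (\int[nu]_y (ft y * u y)%:E = (sigma `^ (1 - p))%:E)%E.
  rewrite -[RHS]mule1 -ftp -ge0_integralZl//; last 3 first.
  - exact: mpow.
  - by move=> y _; rewrite lee_fin powR_ge0.
  - by rewrite lee_fin powR_ge0.
  apply: eq_integral => y _; rewrite -EFinM; congr (_%:E).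
  rewrite /ft powRM ?powR_ge0 ?(ltW s0)// mulrA -powRD; last first.
    by apply/implyP => _; rewrite gt_eqF.
  rewrite subrK powRr1 ?(ltW s0)// -mulrA -powRrM; congr (_ * _).
  rewrite -{2}[u y]powRr1 ?(ltW (u0 y))// -powRD; last first.
    by apply/implyP => _; rewrite gt_eqF.
  by congr (_ `^ _); rewrite /gam; field.
have key : ((sigma `^ (1 - p))%:E <= IA)%E.
  have : (1 <= (1 - p)%:E + (p * sigma `^ (p - 1))%:E * IA)%E.
    rewrite -[leLHS]fp -[X in (_ <= X + _)%E]mule1 -[X in (_ <= _ * X + _)%E]ftp -uf.
    rewrite -ge0_integralZl//; last 3 first.
    - exact: mpow.
    - by move=> y _; rewrite lee_fin powR_ge0.
    - by rewrite lee_fin ltW.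
    have mfu : measurable_fun [set: Y] (fun y => (f y * u y)%:E).
      by apply/measurable_EFinP; exact: measurable_funM.
    rewrite -ge0_integralZl//; last 2 first.
    - by move=> y _; rewrite lee_fin mulr_ge0// ltW.
    - by rewrite lee_fin mulr_ge0 ?powR_ge0// ltW.
    rewrite -ge0_integralD//; last 4 first.
    - by move=> y _; rewrite mule_ge0 ?lee_fin ?powR_ge0// ltW.
    - by apply: measurable_funeM; exact: mpow.
    - by move=> y _; rewrite mule_ge0 ?lee_fin// ?mulr_ge0 ?powR_ge0// ltW.
    - by apply: measurable_funeM.
    apply: ge0_le_integral => //.
    - by move=> y _; rewrite lee_fin powR_ge0.
    - exact: mpow.
    - apply: emeasurable_funD; first by apply: measurable_funeM; exact: mpow.
      by apply: measurable_funeM.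
    move=> y _; rewrite -!EFinM -EFinD lee_fin.
    have p01 : 0 < p < 1 by rewrite p0.
    have := @powR_weighted_AGM R p (f y * ft y `^ (p - 1)) (ft y `^ p) p01.
    rewrite mulr_ge0 ?powR_ge0// => /(_ isT isT).
    rewrite powRM ?powR_ge0// -!powRrM -mulrA -powRD; last first.
      by apply/implyP => _; rewrite gt_eqF.
    have -> : (p - 1) * p + p * (1 - p) = 0 by ring.
    rewrite powRr0 mulr1 addrC => /le_trans; apply.
    rewrite lerD2l le_eqVlt; apply/orP; left; apply/eqP.
    rewrite /ft powRM ?powR_ge0 ?(ltW s0)// -powRrM.
    have -> : - gam * (p - 1) = 1 by rewrite /gam; field.
    by rewrite powRr1 ?(ltW (u0 y))//; ring.
  case: IA Ioo IA0 {uf} => [I| |]// _ _.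
  rewrite -EFinM -EFinD !lee_fin => H.
  have : 1 <= sigma `^ (p - 1) * I.
    have : 0 <= p * (sigma `^ (p - 1) * I - 1) by lra.
    by rewrite pmulr_rge0// subr_ge0.
  have -> : p - 1 = - (1 - p) by ring.
  by rewrite powRN ler_pdivlMl ?powR_gt0// mulr1.
pose th := (1 - q)^-1.
have q1 : 0 < 1 - q by lra.
have q1n : 1 - q != 0 by rewrite gt_eqF.
have th0 : 0 < th by rewrite invr_gt0.
have th1 : th < 1 by rewrite invf_lt1//; lra.
have th1' : 0 <= 1 - th by lra.
have Tft0 := transform_ge0 (fun y => ltW (ft0 y)).
have mTft := measurable_transform mft (fun y => ltW (ft0 y)).
have mJ : measurable_fun A (fun x => epow (transform ft x) q).
  by apply: measurable_funTS; exact: (measurableT_comp (measurable_epow _)).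
have mL : measurable_fun A (fun x => (b x `^ (q - 1))%:E * transform ft x)%E.
  apply: measurable_funTS; apply: emeasurable_funM => //; apply/measurable_EFinP.
  exact: (measurableT_comp (measurable_powR _)).
have : (IA <= th%:E * \int[mu]_(x in A) epow (transform ft x) q +
     (1 - th)%:E * IA)%E.
  apply: (@le_trans _ _ (th%:E * \int[mu]_(x in A) epow (transform ft x) q +
     (1 - th)%:E * (sigma `^ (1 - p))%:E)%E); last first.
    by rewrite leeD2l// lee_pmul2l// lte_fin; lra.
  rewrite -uft duality//; last by move=> y; exact: ltW.
  rewrite -ge0_integralZl//; last 2 first.
  - by move=> x _; exact: epow_ge0.
  - by rewrite lee_fin ltW.
  rewrite -ge0_integralZl//; last first.
  - by move=> x _; rewrite mule_ge0// lee_fin powR_ge0.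
  rewrite -ge0_integralD//; last 4 first.
  - by move=> x _; rewrite mule_ge0 ?epow_ge0// lee_fin ltW.
  - exact: measurable_funeM.
  - by move=> x _; rewrite !mule_ge0// lee_fin powR_ge0.
  - exact: measurable_funeM.
  apply: ge0_le_integral => //.
  - by move=> x _; rewrite lee_fin powR_ge0.
  - apply/measurable_EFinP/measurable_funTS.
    exact: (measurableT_comp (measurable_powR _)).
  - by apply: emeasurable_funD; exact: measurable_funeM.
  move=> x Ax; have bx := b0 _ Ax; have := Tft0 x.
  case: (transform ft x) => [a| |]//; last first.
    move=> _; rewrite mulry gtr0_sg ?powR_gt0// mul1e mulry gtr0_sg ?subr_gt0// mul1e.
    rewrite addey ?leey// -ltNye (lt_le_trans (ltNyr 0))// mule_ge0 ?epow_ge0//.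
    by rewrite lee_fin ltW.
  rewrite lee_fin le_eqVlt => /predU1P[<-|a0].
    rewrite /epow q0 eqxx mulry gtr0_sg// mul1e mule0 mule0 adde0 leey//.
  rewrite epow_EFin// -!EFinM -EFinD lee_fin.
  have th01 : 0 < th < 1 by rewrite th0.
  have := @powR_weighted_AGM R th (a `^ q) (b x `^ (q - 1) * a) th01.
  rewrite powR_ge0 mulr_ge0 ?powR_ge0 ?(ltW a0)// => /(_ isT isT).
  rewrite powRM ?powR_ge0 ?(ltW a0)// -!powRrM mulrCA -powRD; last first.
    by apply/implyP => _; rewrite gt_eqF.
  have -> : q * th + (1 - th) = 0 by rewrite /th; field.
  have -> : (q - 1) * (1 - th) = q by rewrite /th; field.
  by rewrite powRr0 mulr1.
case: IA Ioo IA0 {uf key} => [I| |]// _ _.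
have : (0 <= \int[mu]_(x in A) epow (transform ft x) q)%E.
  by apply: integral_ge0 => x _; exact: epow_ge0.
case: (\int[mu]_(x in A) _)%E => [J| |]// _; last by move=> _; rewrite leey.
rewrite -!EFinM -EFinD !lee_fin => H.
have : 0 <= th * (J - I) by lra.
by rewrite pmulr_rge0// subr_ge0.
Qed.

End improvement.

(** * Candidates and two-sided bounds on their transforms *)

Section half_space_kernel.
Context (R : realType) (m : nat).
Notation LX := (lebesgue_tuple R m.+1).
Notation LY := (lebesgue_tuple R m).
Notation D := (half_space R m.+1).
Notation bd := (@boundary_point R m.+1).
Notation dxy x y := (edist x (bd y)).
Variables (lambda beta : R).

Definition weight n (x : Rn R n) : R := 1 + edist x (origin R n).

Definition hs_kernel (x : Rn R m.+1) (y : Rn R m) : R :=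
  (x`_m : R) `^ beta * dxy x y `^ lambda.

Lemma hs_kernel_ge0 x y : 0 <= hs_kernel x y.
Proof. by rewrite mulr_ge0 ?powR_ge0. Qed.

Lemma measurable_nth_last : measurable_fun [set: Rn R m.+1] (fun x => x`_m : R).
Proof.
rewrite (_ : (fun x : Rn R m.+1 => _) = (fun x : Rn R m.+1 => (tnth x ord_max : R))).
  exact: measurable_tnth_R.
by apply/funext => x; rewrite nth_last_tnth.
Qed.

Lemma measurable_hs_kernel :
  measurable_fun [set: Rn R m.+1 * Rn R m] (fun z => hs_kernel z.1 z.2).
Proof.
apply: measurable_funM.
  apply: (@measurableT_comp _ _ _ _ _ _ (fun x : Rn R m.+1 => (x`_m : R) `^ beta) _ fst) => //.
  by apply: (measurableT_comp (measurable_powR _)); exact: measurable_nth_last.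
apply: (measurableT_comp (measurable_powR _)); apply: measurable_edist => //.
by apply: (measurableT_comp (@measurable_boundary_point R m)).
Qed.

Lemma weight_ge1 n (x : Rn R n) : 1 <= weight x.
Proof. by rewrite lerDl edist_ge0. Qed.

Lemma weight_gt0 n (x : Rn R n) : 0 < weight x.
Proof. exact: lt_le_trans ltr01 (weight_ge1 x). Qed.

Lemma measurable_weight_powR n s : measurable_fun [set: Rn R n] (fun x => weight x `^ s).
Proof. exact: measurable_powR_norm. Qed.

Lemma edist_boundary_le_weight (x : Rn R m.+1) (y : Rn R m) :
  dxy x y <= weight x * weight y.
Proof.
apply: (@le_trans _ _ (edist x (origin R m.+1) + edist y (origin R m))).
  rewrite -(edist_boundary_point y) boundary_point_origin (edistC (bd y)).
  exact: edist_triangle.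
have := edist_ge0 x (origin R _); have := edist_ge0 y (origin R _).
by rewrite /weight; nra.
Qed.

(** Potentials [\int |x - y| `^ lambda d nu(x)] of a measure of mass [M], once
    centred and rescaled, satisfy the last condition for all [eta > 0], whatever
    the position of [lambda] with respect to [1]; it yields a local
    modulus of continuity common to the whole class and, unlike continuity itself,
    passes to pointwise limits. *)
Definition tame (c C M : R) (u : Rn R m -> R) : Prop :=
  [/\ measurable_fun [set: Rn R m] u,
      forall y, c * weight y `^ lambda <= u y <= C * weight y `^ lambda &
      forall eta y z, 0 < eta -> u y <= (1 + eta) `^ lambda * u z +
        M * ((1 + eta^-1) `^ lambda * edist y z `^ lambda)].

Definition cand (gam : R) (u : Rn R m -> R) (y : Rn R m) : R := u y `^ (- gam).

Hypothesis m0 : (0 < m)%N.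
Hypothesis lam0 : 0 < lambda.
Variables (gam c C M : R).
Hypothesis gam0 : 0 < gam.
Hypothesis c0 : 0 < c.
Hypothesis C0 : 0 < C.
(* For [gam = 1 / (1 - p)] one has [gam - 1 = p * gam], so this is the condition for
   [cand] to have a finite [p]-norm. *)
Hypothesis lamgam : m%:R < lambda * (gam - 1).

Let T := transform LY hs_kernel.

Section one_candidate.
Variable u : Rn R m -> R.
Hypothesis tu : tame c C M u.

Lemma tame_gt0 y : 0 < u y.
Proof.
have [_ /(_ y)/andP[h _] _] := tu; apply: lt_le_trans h.
by rewrite mulr_gt0 ?powR_gt0 ?weight_gt0.
Qed.

Lemma cand_gt0 y : 0 < cand gam u y.
Proof. by rewrite powR_gt0 ?tame_gt0. Qed.

Lemma measurable_cand : measurable_fun [set: Rn R m] (cand gam u).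
Proof. by have [mu_ _ _] := tu; exact: (measurableT_comp (measurable_powR _)). Qed.

Lemma cand_le y : cand gam u y <= c `^ (- gam) * weight y `^ (- (lambda * gam)).
Proof.
have [_ /(_ y)/andP[h _] _] := tu.
have w0 := powR_gt0 lambda (weight_gt0 y).
rewrite /cand -mulrN powRrM -powRM ?(ltW c0) ?(ltW w0)//.
by apply: powR_antitone; rewrite ?oppr_le0 ?(ltW gam0) ?mulr_gt0 ?tame_gt0.
Qed.

Lemma cand_ge y : C `^ (- gam) * weight y `^ (- (lambda * gam)) <= cand gam u y.
Proof.
have [_ /(_ y)/andP[_ h] _] := tu.
have w0 := powR_gt0 lambda (weight_gt0 y).
rewrite /cand -mulrN powRrM -powRM ?(ltW C0) ?(ltW w0)//.
by apply: powR_antitone; rewrite ?oppr_le0 ?(ltW gam0) ?mulr_gt0 ?tame_gt0.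
Qed.

(** The factor [weight y] left over has the exponent of the [p]-th power of the
    candidate (as [p * gam = gam - 1]), so the same integrable majorant serves for
    the normalization and for the transform. *)
Lemma kernel_cand_le x y :
  hs_kernel x y * cand gam u y <=
  (x`_m : R) `^ beta * weight x `^ lambda * c `^ (- gam) *
    weight y `^ (- (lambda * (gam - 1))).
Proof.
rewrite /hs_kernel -!mulrA ler_wpM2l ?powR_ge0//.
apply: (@le_trans _ _ ((weight x * weight y) `^ lambda *
    (c `^ (- gam) * weight y `^ (- (lambda * gam))))).
  apply: ler_pM; rewrite ?powR_ge0 ?cand_le ?(ltW (cand_gt0 _))//.
  apply: ge0_ler_powR; rewrite ?nnegrE ?edist_ge0 ?(ltW lam0)//.
    by rewrite mulr_ge0// ltW// weight_gt0.
  exact: edist_boundary_le_weight.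
rewrite powRM ?(ltW (weight_gt0 _))// le_eqVlt; apply/orP; left; apply/eqP.
have -> : - (lambda * (gam - 1)) = lambda + - (lambda * gam) by ring.
rewrite powRD; first by ring.
by apply/implyP => _; rewrite gt_eqF// weight_gt0.
Qed.

End one_candidate.

Lemma integral_weight_lty :
  (\int[LY]_y (weight y `^ (- (lambda * (gam - 1))))%:E < +oo)%E.
Proof. exact: integral_norm_powR_lty. Qed.

Lemma integrable_weight k : LY.-integrable setT
  (fun y => (k * weight y `^ (- (lambda * (gam - 1))))%:E).
Proof.
rewrite (_ : (fun _ => _) = (fun y => k%:E * (weight y `^ (- (lambda * (gam - 1))))%:E)%E); last first.
  by apply/funext => y; rewrite EFinM.
apply: integrableZl => //; apply/integrableP; split.
  by apply/measurable_EFinP; exact: measurable_weight_powR.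
under eq_integral do rewrite gee0_abs ?lee_fin ?powR_ge0//.
exact: integral_weight_lty.
Qed.

Lemma transform_cand_lty u : tame c C M u -> forall x, (T (cand gam u) x < +oo)%E.
Proof.
move=> tu x; pose k := (x`_m : R) `^ beta * weight x `^ lambda * c `^ (- gam).
have k0 : 0 <= k by rewrite !mulr_ge0 ?powR_ge0.
apply: (@le_lt_trans _ _ (\int[LY]_y (k * weight y `^ (- (lambda * (gam - 1))))%:E)%E).
  apply: ge0_le_integral => //.
  - by move=> y _; rewrite lee_fin mulr_ge0 ?hs_kernel_ge0// ltW// cand_gt0.
  - apply/measurable_EFinP; apply: measurable_funM; last exact: measurable_cand.
    exact: (measurable_kernel_section measurable_hs_kernel).
  - apply/measurable_EFinP; apply: measurable_funM => //; exact: measurable_weight_powR.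
  - by move=> y _; rewrite lee_fin kernel_cand_le.
under eq_integral do rewrite EFinM.
rewrite ge0_integralZl//; first last.
- by move=> y _; rewrite lee_fin powR_ge0.
- by apply/measurable_EFinP; exact: measurable_weight_powR.
apply: lte_mul_pinfty => //; exact: integral_weight_lty.
Qed.

Definition cube (s : R) : set (Rn R m) :=
  [set y | forall i, (`[s, s + 1]%classic : set (measurableTypeR R)) (tnth y i)].

Lemma measurable_cube s : measurable (cube s).
Proof.
rewrite (_ : cube s =
    \bigcap_(i in [set: 'I_m]) ((fun x : Rn R m => tnth x i : R) @^-1` `[s, s + 1])).
  apply: fin_bigcap_measurable => // i _.
  by rewrite -[X in measurable X]setTI; exact: measurable_tnth_R.
by apply/seteqP; split => x /= Ax i *; exact: Ax.
Qed.

Lemma lebesgue_cube s : LY (cube s) = 1%E.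
Proof.
rewrite [LHS](@lebesgue_tuple_box R m (fun=> `[s, s + 1]%classic))// big1// => i _.
rewrite lebesgue_measure_itv/= lte_fin ltrDl ltr01.
by rewrite -EFinB addrAC subrr add0r.
Qed.

Lemma weight_cube_le s (y : Rn R m) : 0 <= s -> cube s y -> weight y <= 1 + m%:R * (s + 1).
Proof.
move=> s0 ys; rewrite lerD2l; apply: le_trans (edist_le_sum _ _) _.
apply: (@le_trans _ _ (\sum_(i < m) (s + 1))).
  apply: ler_sum => i _; rewrite tnth_mktuple subr0.
  by have := ys i; rewrite /= in_itv/= => /andP[h1 h2]; rewrite ger0_norm//; lra.
by rewrite sumr_const card_ord mulr_natl.
Qed.

(** No point is close to both cubes, because they are at distance at least [1]
    from each other. *)
Lemma weight_le_two_points (x : Rn R m.+1) (y z : Rn R m) : cube 0 y -> cube 2 z ->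
  weight x <= (m%:R + 2) * (dxy x y + dxy x z).
Proof.
move=> y0 z2; pose i0 : 'I_m := Ordinal m0.
have yz : 1 <= dxy x y + dxy x z.
  have := edist_triangle (bd y) x (bd z); rewrite edist_boundary_point (edistC (bd y)).
  have := le_edist_tnth z y i0; rewrite (edistC z).
  have := y0 i0; have := z2 i0; rewrite /= !in_itv/= => /andP[h1 h2] /andP[h3 h4].
  by have := ler_norm ((tnth z i0 : R) - tnth y i0); lra.
have y1 : weight y <= 1 + m%:R * (0 + 1) by apply: weight_cube_le.
have := edist_triangle x (bd y) (origin R m.+1).
rewrite -boundary_point_origin edist_boundary_point boundary_point_origin => h.
have dz := edist_ge0 x (bd z); have dy := edist_ge0 x (bd y).
have mR : 0 <= m%:R :> R by [].
rewrite /weight in y1 *; nra.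
Qed.

Definition transform_lower : R :=
  C `^ (- gam) * (1 + m%:R * 3) `^ (- (lambda * gam)) * (2 * (m%:R + 2)) `^ (- lambda).

Lemma transform_lower_gt0 : 0 < transform_lower.
Proof.
have mR : 0 <= m%:R :> R by [].
by rewrite !mulr_gt0 ?powR_gt0//; lra.
Qed.

(** The point [x] is at distance comparable to [1 + |x|] from one of two fixed
    unit cubes, on which the candidate is bounded below. *)
Lemma transform_cand_ge u : tame c C M u -> forall x : Rn R m.+1,
  ((transform_lower * ((x`_m : R) `^ beta * weight x `^ lambda))%:E <= T (cand gam u) x)%E.
Proof.
move=> tu x; have mR : 0 <= m%:R :> R by [].
pose B : R := 2 * (m%:R + 2); have B0 : 0 < B by rewrite /B; lra.
have wx := weight_gt0 x.
have [s s02 far] : exists2 s : R, 0 <= s <= 2 & forall y, cube s y -> weight x / B <= dxy x y.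
  have [H|] := pselect (forall y, cube 0 y -> weight x / B <= dxy x y); first by exists 0 => //; lra.
  move=> /existsNP[y /not_implyP[y0 /negP]]; rewrite -ltNge => dy.
  exists 2; first by lra.
  move=> z z2; rewrite leNgt; apply/negP => dz.
  have := weight_le_two_points x y0 z2; apply/negP; rewrite -ltNge.
  have -> : weight x = (m%:R + 2) * (weight x / B + weight x / B).
    by rewrite /B; field; lra.
  by rewrite ltr_pM2l; lra.
pose k := transform_lower * ((x`_m : R) `^ beta * weight x `^ lambda).
have lo y : cube s y -> k <= hs_kernel x y * cand gam u y.
  move=> ys; apply: (@le_trans _ _ (((x`_m : R) `^ beta * (weight x / B) `^ lambda) *
      (C `^ (- gam) * (1 + m%:R * 3) `^ (- (lambda * gam))))).
    rewrite le_eqVlt; apply/orP; left; apply/eqP; rewrite /k /transform_lower.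
    rewrite [(weight x / B) `^ _]powRM ?(ltW wx) ?invr_ge0 ?(ltW B0)// -/B.
    have -> : B^-1 `^ lambda = B `^ (- lambda).
      by rewrite -(powR_inv1 (ltW B0)) -powRrM mulN1r.
    ring.
  apply: ler_pM; rewrite ?mulr_ge0 ?powR_ge0//.
    rewrite ler_wpM2l ?powR_ge0//; apply: ge0_ler_powR; rewrite ?nnegrE ?edist_ge0 ?(ltW lam0)//.
      by rewrite divr_ge0// ltW.
    exact: far.
  apply: le_trans (cand_ge tu y); rewrite ler_wpM2l ?powR_ge0// !powRN.
  have w0 := weight_gt0 y.
  have m30 : 0 < 1 + m%:R * 3 :> R by lra.
  rewrite lef_pV2 ?posrE ?powR_gt0//.
  apply: ge0_ler_powR; rewrite ?nnegrE ?mulr_ge0 ?(ltW lam0) ?(ltW gam0) ?(ltW w0) ?(ltW m30)//.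
  have /andP[s0 s2] := s02.
  by apply: le_trans (weight_cube_le s0 ys) _; rewrite lerD2l ler_wpM2l//; lra.
have kernel0 y : (0 <= (hs_kernel x y * cand gam u y)%:E)%E.
  by rewrite lee_fin mulr_ge0 ?hs_kernel_ge0// ltW// cand_gt0.
have mk : measurable_fun [set: Rn R m] (fun y => (hs_kernel x y * cand gam u y)%:E).
  apply/measurable_EFinP; apply: measurable_funM; last exact: measurable_cand.
  exact: (measurable_kernel_section measurable_hs_kernel).
apply: (@le_trans _ _ (\int[LY]_(y in cube s) (hs_kernel x y * cand gam u y)%:E)%E).
  apply: (@le_trans _ _ (\int[LY]_(y in cube s) (cst k%:E) y)%E).
    rewrite integral_cst; last exact: measurable_cube.
    by have /= -> := lebesgue_cube s; rewrite mule1.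
  apply: ge0_le_integral => //; first exact: measurable_cube.
  - move=> y _; rewrite lee_fin /k mulr_ge0 ?(ltW transform_lower_gt0)//.
    by rewrite mulr_ge0 ?powR_ge0.
  - exact: measurable_funTS.
apply: ge0_subset_integral => //; exact: measurable_cube.
Qed.

End half_space_kernel.

(** * Sequential compactness of tame functions *)

Section pointwise_compactness.
Import ArrowAsProduct.
Context (R : realType) (m : nat).

(** An enumeration of the rational points; codes of no tuple give the origin. *)
Definition rational_point (k : nat) : Rn R m :=
  if unpickle k is Some t then [tuple (ratr (tnth (t : m.-tuple rat) i) : R) | i < m]
  else origin R m.

Lemma rational_point_dense (y : Rn R m) (d : R) : 0 < d ->
  exists k, edist y (rational_point k) < d.
Proof.
move=> d0; have m1 : 0 < m.+1%:R :> R by [].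
have H (i : 'I_m) : exists r : rat, `|(tnth y i : R) - ratr r| < d / m.+1%:R.
  have /rat_in_itvoo[r] : (tnth y i : R) - d / m.+1%:R < (tnth y i : R) + d / m.+1%:R.
    by rewrite ltrBlDr -addrA ltrDl addr_gt0 ?divr_gt0.
  rewrite in_itv/= => /andP[h1 h2]; exists r; rewrite ltr_norml.
  by rewrite ltrNl opprB ltrBlDl h2/= ltrBlDr addrC -ltrBlDr.
pose t : m.-tuple rat := [tuple projT1 (cid (H i)) | i < m].
exists (pickle t); rewrite /rational_point pickleK.
apply: le_lt_trans (edist_le_sum _ _) _.
apply: (@le_lt_trans _ _ (\sum_(i < m) (d / m.+1%:R))).
  apply: ler_sum => i _; rewrite !tnth_mktuple.
  by case: cid => r /= /ltW.
rewrite sumr_const card_ord -(mulr_natr (d / _)) mulrAC ltr_pdivrMr// ltr_pM2l//.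
by rewrite ltr_nat.
Qed.

(** Tychonoff's theorem gives a cluster point [u] of the sequence in the product
    topology. Finitely many coordinates can be approximated at a time, so some
    subsequence converges to [u] on the countable dense set of rational points,
    hence everywhere by equicontinuity. *)
Lemma pointwise_subsequence (u_ : nat -> Rn R m -> R) (B : Rn R m -> R) :
  (forall j y, 0 <= u_ j y <= B y) ->
  (forall y e, 0 < e -> exists2 d, 0 < d &
    forall j z, edist y z < d -> `|u_ j y - u_ j z| <= e) ->
  exists (u : Rn R m -> R) (phi : nat -> nat), (forall k, (k <= phi k)%N) /\
    forall y, u_ (phi k) y @[k --> \oo] --> u y.
Proof.
move=> uB uE.
pose A (y : Rn R m) : set R := `[0, B y]%classic.
have cA := @tychonoff (Rn R m) (fun=> R) A (fun y => @segment_compact R 0 (B y)).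
pose F := nbhs (u_ j @[j --> \oo]).
have FA : F [set f | forall y, A y (f y)].
  by exists 0%N => // j _ y; rewrite /A/= in_itv/=; exact: uB.
have PF : ProperFilter F by exact: fmap_proper_filter.
have [u [_ clu]] := cA F PF FA.
have near_u (s : seq (Rn R m)) (e : R) (k : nat) : 0 < e ->
    exists2 j, (k <= j)%N & forall y, y \in s -> `|u y - u_ j y| < e.
  move=> e0; pose V : set (Rn R m -> R) := [set w | forall y, y \in s -> `|u y - w y| < e].
  have nV : @nbhs _ (forall y : Rn R m, R) u V.
    rewrite /V; elim: s {V} => [|y s IH].
      by apply: filterS filterT => w _ y; rewrite in_nil.
    have ny : @nbhs _ (forall y : Rn R m, R) u
        [set w | `|u y - w y| < e].
      have /cvgrPdist_lt := @proj_continuous (Rn R m) (fun=> R) y u.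
      by apply.
    apply: filterS (filterI ny IH) => w /= [wy ws] z.
    by rewrite in_cons => /predU1P[->|/ws].
  have Fk : F [set u_ j | j in [set j | (k <= j)%N]] by exists k => // j kj; exists j.
  by have [_ [[j kj <-] Vj]] := clu _ _ Fk nV; exists j.
have /choice[phi phiP] k : exists j, (k <= j)%N /\
    forall y, y \in [seq rational_point i | i <- iota 0 k] -> `|u y - u_ j y| < k.+1%:R^-1.
  have [|j kj h] := near_u [seq rational_point i | i <- iota 0 k] k.+1%:R^-1 k.
    by rewrite invr_gt0.
  by exists j.
exists u, phi; split=> [k|y]; first by have [] := phiP k.
apply/cvgrPdist_le => e e0; have e4 : 0 < e / 4 by rewrite divr_gt0.
have [d d0 ud] := uE y _ e4.
have [i yi] := rational_point_dense y d0.
have ue : `|u y - u (rational_point i)| <= e / 4 + e / 4.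
  have e8 : 0 < e / 8 by rewrite divr_gt0.
  have [j _ jP] := near_u [:: y; rational_point i] _ 0%N e8.
  have := jP y; rewrite mem_head => /(_ isT) h1.
  have := jP (rational_point i); rewrite in_cons mem_head orbT => /(_ isT) h2.
  have h3 := ud j _ yi.
  move: h1 h2 h3; rewrite !ltr_norml !ler_norml => /andP[? ?] /andP[? ?] /andP[? ?].
  by apply/andP; split; lra.
near=> k; have [kphi kP] := phiP k.
have ki : (i < k)%N by near: k; exists i.+1.
have ke : k.+1%:R^-1 <= e / 4.
  rewrite invf_ple ?posrE//; apply: ltW; apply: lt_le_trans (truncnS_gt _) _.
  by rewrite ler_nat ltnS; near: k; exact: nbhs_infty_ge.
have h1 := kP (rational_point i) (map_f _ _).
rewrite mem_iota add0n ki in h1.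
have {}h1 := le_trans (ltW (h1 isT)) ke; have h2 := ud (phi k) _ yi.
move: ue h1 h2; rewrite !ler_norml => /andP[? ?] /andP[? ?] /andP[? ?].
by apply/andP; split; lra.
Unshelve. all: by end_near. Qed.

End pointwise_compactness.

Section tame_compactness.
Context (R : realType) (m : nat).
Variables (lambda c C M : R).
Hypothesis lam0 : 0 < lambda.
Hypothesis c0 : 0 < c.
Hypothesis C0 : 0 < C.
Hypothesis M0 : 0 < M.

(** Take [eta] so small that [((1 + eta) `^ lambda - 1) * u z <= e / 2] near [y], and
    then [d] so small that the remaining term is at most [e / 2]. *)
Lemma tame_equicontinuous (y : Rn R m) (e : R) : 0 < e -> exists2 d, 0 < d &
  forall u z, tame lambda c C M u -> edist y z < d -> `|u y - u z| <= e.
Proof.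
move=> e0; pose B := C * (weight y + 1) `^ lambda.
have wy := weight_gt0 y.
have B0 : 0 < B by rewrite mulr_gt0 ?powR_gt0//; lra.
pose eta := (1 + e / (2 * B)) `^ lambda^-1 - 1.
have eB : 0 < e / (2 * B) by apply: divr_gt0 => //; exact: mulr_gt0.
have il0 : 0 < lambda^-1 by rewrite invr_gt0.
have eta0 : 0 < eta.
  have E1 : 1 `^ lambda^-1 = 1 :> R by rewrite powR1.
  by rewrite subr_gt0 -[ltLHS]E1 gt0_ltr_powR ?nnegrE//; lra.
have etaE : (1 + eta) `^ lambda = 1 + e / (2 * B).
  by rewrite /eta subrKC -powRrM mulVf ?gt_eqF// powRr1//; lra.
pose G := M * (1 + eta^-1) `^ lambda.
have G0 : 0 < G by rewrite mulr_gt0 ?powR_gt0 ?addr_gt0 ?invr_gt0.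
pose d := Num.min 1 ((e / (2 * G)) `^ lambda^-1).
have eG : 0 < e / (2 * G) by apply: divr_gt0 => //; exact: mulr_gt0.
exists d; first by rewrite lt_min ltr01 powR_gt0.
move=> u z [_ ub um]; rewrite lt_min => /andP[yz1 yzG].
have wz : weight z <= weight y + 1.
  have := edist_triangle z y (origin R m); rewrite (edistC z y) /weight; lra.
have uB w : weight w <= weight y + 1 -> 0 <= u w <= B.
  move=> ww; have /andP[h1 h2] := ub w; have w0 := weight_gt0 w.
  apply/andP; split; first by apply: le_trans h1; rewrite mulr_ge0 ?powR_ge0// ltW.
  apply: le_trans h2 _; rewrite ler_wpM2l ?(ltW C0)//.
  by apply: ge0_ler_powR; rewrite ?nnegrE ?(ltW lam0)//; lra.
have yzl : G * edist y z `^ lambda <= e / 2.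
  apply: (@le_trans _ _ (G * (e / (2 * G)))).
    rewrite ler_wpM2l ?(ltW G0)//.
    rewrite -[leRHS]powRr1 ?(ltW eG)// -[X in _ <= _ `^ X](mulVf (lt0r_neq0 lam0)) powRrM.
    by apply: ge0_ler_powR; rewrite ?nnegrE ?edist_ge0 ?powR_ge0 ?(ltW lam0)// ltW.
  by rewrite le_eqVlt; apply/orP; left; apply/eqP; field; lra.
have half w : 0 <= u w <= B -> e / (2 * B) * u w <= e / 2.
  move=> /andP[w0 wB]; apply: (@le_trans _ _ (e / (2 * B) * B)).
    by rewrite ler_wpM2l// ltW.
  by rewrite le_eqVlt; apply/orP; left; apply/eqP; field; lra.
have hz := half _ (uB _ wz).
have wy1 : weight y <= weight y + 1 by lra.
have hy := half _ (uB _ wy1).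
have h1 := um eta y z eta0; have h2 := um eta z y eta0.
rewrite edistC in h2; rewrite etaE mulrA -/G in h1 h2.
rewrite ler_norml; apply/andP; split; lra.
Qed.

Lemma tame_limit (u_ : nat -> Rn R m -> R) u :
  (forall j, tame lambda c C M (u_ j)) ->
  (forall y, u_ j y @[j --> \oo] --> u y) -> tame lambda c C M u.
Proof.
move=> tu uu; split.
- apply: (@measurable_fun_cvg _ _ _ _ u_) => [j|y _]; last exact: uu.
  by have [] := tu j.
- move=> y; apply/andP; split.
    by apply: (cvgr_to_ge (uu y)); apply: nearW => j; have [_ /(_ y)/andP[]] := tu j.
  by apply: (cvgr_to_le (uu y)); apply: nearW => j; have [_ /(_ y)/andP[]] := tu j.
- move=> eta y z eta0.
  have h : ((1 + eta) `^ lambda * u_ j z +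
      M * ((1 + eta^-1) `^ lambda * edist y z `^ lambda)) @[j --> \oo] -->
      (1 + eta) `^ lambda * u z + M * ((1 + eta^-1) `^ lambda * edist y z `^ lambda).
    by apply: cvgD; [apply: cvgMr; exact: uu|exact: cvg_cst].
  by apply: (ler_cvg_to (uu y) h); apply: nearW => j; have [_ _] := tu j; apply.
Qed.

Lemma tame_subsequence (u_ : nat -> Rn R m -> R) :
  (forall j, tame lambda c C M (u_ j)) ->
  exists (u : Rn R m -> R) (phi : nat -> nat), [/\ (forall k, (k <= phi k)%N),
    tame lambda c C M u & forall y, u_ (phi k) y @[k --> \oo] --> u y].
Proof.
move=> tu.
have [||u [phi [phik uphi]]] := @pointwise_subsequence R m u_
    (fun y => C * weight y `^ lambda).
- move=> j y; have [_ /(_ y)/andP[h ->] _] := tu j; rewrite andbT.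
  by apply: le_trans h; rewrite mulr_ge0 ?powR_ge0// ltW.
- move=> y e e0; have [d d0 h] := tame_equicontinuous y e0.
  by exists d => // j z; apply: h.
exists u, phi; split => //.
by apply: (@tame_limit (fun k => u_ (phi k))) => // k.
Qed.

End tame_compactness.

(** * Maximizing the energy over a normalized class *)

Lemma powR_cvg (R : realType) (s : R) (u : R^nat) (l : R) : 0 < l ->
  u j @[j --> \oo] --> l -> u j `^ s @[j --> \oo] --> l `^ s.
Proof.
move=> l0 ul; have H := is_derive1_powR s l0.
have cl : {for l, continuous (fun t : R => t `^ s)}.
  by apply: differentiable_continuous; apply/derivable1_diffP; have [] := H.
exact: (cvg_comp _ _ ul cl).
Qed.

Section attainment.
Context (R : realType) (m : nat).
Notation LX := (lebesgue_tuple R m.+1).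
Notation LY := (lebesgue_tuple R m).
Notation D := (half_space R m.+1).
Variables (lambda beta gam c C M q : R).
Hypothesis m0 : (0 < m)%N.
Hypothesis lam0 : 0 < lambda.
Hypothesis beta0 : 0 <= beta.
Hypothesis gam1 : 1 < gam.
Hypothesis lamgam : m%:R < lambda * (gam - 1).
Hypothesis q0 : q < 0.
Hypothesis bq : -1 < beta * q.
Hypothesis lq : m.+1%:R + beta * q < - (lambda * q).
Hypothesis c0 : 0 < c.
Hypothesis C0 : 0 < C.
Hypothesis M0 : 0 < M.

Let T := transform LY (hs_kernel (m := m) lambda beta).
(** As [q < 0], minimizing the [L^q] norm of the transform amounts to maximizing
    this integral. *)
Definition energy (f : Rn R m -> R) : \bar R :=
  (\int[LX]_(x in D) epow (transform LY (hs_kernel (m := m) lambda beta) f x) q)%E.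
Let gam0 : 0 < gam. Proof. exact: lt_trans ltr01 gam1. Qed.

Definition energy_majorant (x : Rn R m.+1) : R :=
  transform_lower m lambda gam C `^ q *
    ((x`_m : R) `^ (beta * q) * weight x `^ (- - (lambda * q))).

Lemma integrable_energy_majorant : LX.-integrable D (EFin \o energy_majorant).
Proof.
have mw : measurable_fun [set: Rn R m.+1]
    (fun x => (x`_m : R) `^ (beta * q) * weight x `^ (- - (lambda * q))).
  apply: measurable_funM; last exact: measurable_weight_powR.
  by apply: (measurableT_comp (measurable_powR _)); exact: measurable_nth_last.
rewrite (_ : EFin \o _ = fun x : Rn R m.+1 => ((transform_lower m lambda gam C `^ q)%:E *
    ((x`_m : R) `^ (beta * q) * weight x `^ (- - (lambda * q)))%:E)%E); last first.
  by apply/funext => x; rewrite -EFinM.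
apply: integrableZl => //; first exact: measurable_half_space.
apply/integrableP; split; first by apply/measurable_EFinP/measurable_funTS.
under eq_integral do rewrite gee0_abs ?lee_fin ?mulr_ge0 ?powR_ge0//.
apply: integral_half_space_powR_lty => //.
by rewrite mulr_ge0_le0// ltW.
Qed.

Section one.
Variable u : Rn R m -> R.
Hypothesis tu : tame lambda c C M u.

Let F0 y : 0 <= cand gam u y. Proof. exact: powR_ge0. Qed.
Let mF : measurable_fun [set: Rn R m] (cand gam u). Proof. exact: measurable_cand tu. Qed.

Lemma transform_cand_fin x : T (cand gam u) x \is a fin_num.
Proof.
rewrite ge0_fin_numE; last by apply: transform_ge0 => // *; exact: hs_kernel_ge0.
exact: (transform_cand_lty beta m0 lam0 gam0 c0 lamgam tu).
Qed.

Lemma transform_cand_gt0 x : D x -> (0 < T (cand gam u) x)%E.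
Proof.
move=> Dx; apply: lt_le_trans (transform_cand_ge beta m0 lam0 gam0 c0 C0 tu x).
by rewrite lte_fin mulr_gt0 ?transform_lower_gt0// mulr_gt0 ?powR_gt0 ?weight_gt0.
Qed.

Lemma epow_transform_cand_le x : D x ->
  (epow (T (cand gam u) x) q <= (energy_majorant x)%:E)%E.
Proof.
move=> Dx; have x0 : 0 < (x`_m : R) := Dx.
have k0 : 0 < transform_lower m lambda gam C * ((x`_m : R) `^ beta * weight x `^ lambda).
  by rewrite !mulr_gt0 ?powR_gt0 ?weight_gt0 ?transform_lower_gt0.
apply: (@le_trans _ _ (epow
   (transform_lower m lambda gam C * ((x`_m : R) `^ beta * weight x `^ lambda))%:E q)).
  apply: epow_le_neg => //; first by rewrite lee_fin ltW.
  exact: (transform_cand_ge beta m0 lam0 gam0 c0 C0 tu x).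
rewrite epow_EFin// lee_fin /energy_majorant opprK.
rewrite powRM ?mulr_ge0 ?powR_ge0// ?(ltW (transform_lower_gt0 _ _ _ _))//.
by rewrite powRM ?powR_ge0// -!powRrM.
Qed.

Lemma measurable_epow_transform :
  measurable_fun D (fun x => epow (T (cand gam u) x) q).
Proof.
apply: measurable_funTS; apply: (measurableT_comp (measurable_epow _)).
apply: measurable_transform => //; last by move=> *; exact: hs_kernel_ge0.
exact: measurable_hs_kernel.
Qed.

Lemma energy_cand_le : (energy (cand gam u) <= \int[LX]_(x in D) (energy_majorant x)%:E)%E.
Proof.
apply: ge0_le_integral => //; first exact: measurable_half_space.
- by move=> x _; exact: epow_ge0.
- exact: measurable_epow_transform.
- by have /integrableP[] := integrable_energy_majorant.
- exact: epow_transform_cand_le.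
Qed.

End one.

Section limits.
Variables (u_ : nat -> Rn R m -> R) (u : Rn R m -> R).
Hypothesis tu_ : forall j, tame lambda c C M (u_ j).
Hypothesis uu : forall y, u_ j y @[j --> \oo] --> u y.
Let tu : tame lambda c C M u := tame_limit tu_ uu.

Lemma cand_cvg s y : cand s (u_ j) y @[j --> \oo] --> cand s u y.
Proof. by apply: powR_cvg; [exact: tame_gt0 tu y|exact: uu]. Qed.

Lemma integral_cand_cvg :
  (\int[LY]_y (cand (gam - 1) (u_ j) y)%:E)%E @[j --> \oo] -->
  (\int[LY]_y (cand (gam - 1) u y)%:E)%E.
Proof.
apply: (@dominated_cvg _ _ _ LY setT measurableT (fun j y => (cand (gam - 1) (u_ j) y)%:E) _
  (fun y => (c `^ (- (gam - 1)) * weight y `^ (- (lambda * (gam - 1))))%:E)).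
- by move=> j; apply/measurable_EFinP; exact: (measurable_cand _ (tu_ j)).
- by move=> y _; apply: cvg_EFin; [exact: nearW|exact: cand_cvg].
- by [].
- exact: integrable_weight.
- move=> j y _; rewrite gee0_abs ?lee_fin ?powR_ge0//.
  by apply: cand_le (tu_ j) y => //; rewrite subr_gt0.
Qed.

Lemma transform_cand_cvg x :
  T (cand gam (u_ j)) x @[j --> \oo] --> T (cand gam u) x.
Proof.
apply: (@dominated_cvg _ _ _ LY setT measurableT
  (fun j y => (hs_kernel lambda beta x y * cand gam (u_ j) y)%:E) _
  (fun y => ((x`_m : R) `^ beta * weight x `^ lambda * c `^ (- gam) *
     weight y `^ (- (lambda * (gam - 1))))%:E)).
- move=> j; apply/measurable_EFinP; apply: measurable_funM; last exact: measurable_cand (tu_ j).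
  exact: (measurable_kernel_section (@measurable_hs_kernel R m lambda beta)).
- move=> y _; apply: cvg_EFin; first exact: nearW.
  by apply: cvgMr; exact: cand_cvg.
- by [].
- exact: integrable_weight.
- move=> j y _; rewrite gee0_abs ?lee_fin ?mulr_ge0 ?hs_kernel_ge0 ?powR_ge0//.
  exact: (kernel_cand_le beta lam0 gam0 c0 (tu_ j)).
Qed.

Lemma energy_cvg : energy (cand gam (u_ j)) @[j --> \oo] --> energy (cand gam u).
Proof.
have H := @dominated_cvg _ _ _ LX D (@measurable_half_space R m)
  (fun j x => epow (T (cand gam (u_ j)) x) q)
  (fun x => epow (T (cand gam u) x) q) (EFin \o energy_majorant).
apply: H.
- by move=> j; exact: measurable_epow_transform (tu_ j).
- move=> x Dx.
  have E v : tame lambda c C M v ->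
      epow (T (cand gam v) x) q = ((fine (T (cand gam v) x)) `^ q)%:E.
    move=> tv; rewrite -{1}(fineK (transform_cand_fin tv x)) epow_EFin//.
    by rewrite fine_gt0// transform_cand_gt0//= ltey_eq transform_cand_fin.
  rewrite E//; under eq_cvg do rewrite E//.
  apply: cvg_EFin; first exact: nearW.
  apply: powR_cvg.
    by rewrite fine_gt0// transform_cand_gt0//= ltey_eq transform_cand_fin.
  apply: fine_cvg; rewrite fineK ?transform_cand_fin//; exact: transform_cand_cvg.
- by [].
- exact: integrable_energy_majorant.
- move=> j x Dx; rewrite gee0_abs ?epow_ge0//.
  exact: (epow_transform_cand_le (tu_ j) Dx).
Qed.

End limits.

Definition normalized (u : Rn R m -> R) : Prop :=
  tame lambda c C M u /\ (\int[LY]_y (cand (gam - 1) u y)%:E = 1)%E.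

(** The energies are bounded by the integral of the majorant, so the supremum is
    finite; a maximizing sequence has a pointwise convergent subsequence, and both
    the normalization and the energy pass to the limit by dominated convergence. *)
Lemma energy_attained : (exists u, normalized u) ->
  exists2 u, normalized u &
    forall v, normalized v -> (energy (cand gam v) <= energy (cand gam u))%E.
Proof.
move=> [u0 nu0].
pose S := ereal_sup [set energy (cand gam u) | u in normalized].
have energy0 f : (0 <= energy f)%E by apply: integral_ge0 => x _; exact: epow_ge0.
have Sfin : S \is a fin_num.
  rewrite ge0_fin_numE.
    apply: (@le_lt_trans _ _ (\int[LX]_(x in D) (energy_majorant x)%:E)%E).
      by apply: ge_ereal_sup => _ [u [tu _] <-]; exact: energy_cand_le.
    have /integrableP[_] := integrable_energy_majorant.
    apply: le_lt_trans; rewrite le_eqVlt; apply/orP; left; apply/eqP.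
    apply: eq_integral => x _; rewrite gee0_abs// lee_fin.
    by rewrite mulr_ge0 ?powR_ge0// mulr_ge0 ?powR_ge0.
  by apply: le_trans (energy0 (cand gam u0)) _; apply: ereal_sup_ubound; exists u0.
have /choice[u_ u_P] j : exists u, normalized u /\ (S - j.+1%:R^-1%:E < energy (cand gam u))%E.
  have j0 : 0 < j.+1%:R^-1 :> R by rewrite invr_gt0.
  have [_ [u nu <-] h] := ub_ereal_sup_adherent j0 Sfin.
  by exists u.
have [u [phi [phik tu uu]]] := tame_subsequence lam0 c0 C0 M0 (fun j => (u_P j).1.1).
have tuphi k := (u_P (phi k)).1.1.
have nu : normalized u.
  split => //; have h := integral_cand_cvg tuphi uu.
  have h1 : (\int[LY]_y (cand (gam - 1) (u_ (phi k)) y)%:E)%E @[k --> \oo] --> 1%E.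
    rewrite (_ : (fun k => _) = cst 1%E); first exact: cvg_cst.
    by apply/funext => k; exact: (u_P (phi k)).1.2.
  exact: (cvg_unique _ h h1).
exists u; first exact: nu.
move=> v nv; apply: (@le_trans _ _ S).
  by apply: ereal_sup_ubound; exists v.
have h := energy_cvg tuphi uu.
apply/lee_addgt0Pr => e e0.
have Se : (S <= energy (cand gam u) + e%:E)%E = (S - e%:E <= energy (cand gam u))%E.
  by rewrite leeBlDr.
rewrite {}Se; apply: (cvge_to_ge h).
near=> k; apply: le_trans (ltW (u_P (phi k)).2); apply: leeB => //.
rewrite lee_fin invf_ple ?posrE//.
apply: ltW; apply: lt_le_trans (truncnS_gt _) _.
rewrite ler_nat ltnS; apply: leq_trans (phik k).
by near: k; exact: nbhs_infty_ge.
Unshelve. all: by end_near. Qed.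

End attainment.

(** * Normal form of a potential *)

Section affine_normalization.
Context (R : realType) (m : nat).
Variable lambda : R.
Hypothesis lam0 : 0 < lambda.

(** With [profile_upper], the constants between which a potential, once centred
    and rescaled, stays comparable to [(1 + |y|) `^ lambda]; they depend on [lambda]
    alone. *)
Definition profile_lower : R := 2 `^ (- lambda) / (3 * 2 `^ lambda + 2).
Definition profile_upper : R := 2 * 2 `^ lambda.

Lemma profile_lower_gt0 : 0 < profile_lower.
Proof. by rewrite divr_gt0 ?powR_gt0// addr_gt0// mulr_gt0 ?powR_gt0. Qed.

Lemma profile_upper_gt0 : 0 < profile_upper.
Proof. by rewrite mulr_gt0 ?powR_gt0. Qed.

Lemma near_minimizer (u : Rn R m -> R) (d : R) : 0 < d -> (forall y, d <= u y) ->
  exists a, forall y, u a <= 2 * u y.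
Proof.
move=> d0 du; pose E := range u.
have E0 : E !=set0 by exists (u (origin R m)); exists (origin R m).
have lE : has_lbound E by exists d => _ [y _ <-].
have hE : has_inf E by split.
have dE : d <= inf E by apply: lb_le_inf => // _ [y _ <-].
have [_ [a _ <-] h] := inf_adherent (lt_le_trans d0 dE) hE.
exists a => y; apply: (@le_trans _ _ (2 * inf E)); first by lra.
by rewrite ler_pM2l//; apply: ge_inf => //; exists y.
Qed.

(** The heart of compactness. Choose [a] where [u] is within a factor [2] of its
    infimum. The last hypothesis bounds [N * |y - a| `^ lambda] by a multiple of
    [u y], the one before it, taken at [eta = 1], bounds [u y] by a multiple of
    [N * |y - a| `^ lambda + u a]; hence [u] is comparable to the latter with absolute
    constants, and translation by [a] and dilation by [r = (u a / N) `^ (1 / lambda)]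
    turn it into [1 + |y| `^ lambda]. *)
Lemma affine_normalization (u : Rn R m -> R) (N d : R) :
  measurable_fun [set: Rn R m] u -> 0 < N -> 0 < d -> (forall y, d <= u y) ->
  (forall eta y z, 0 < eta -> u y <= (1 + eta) `^ lambda * u z +
     N * ((1 + eta^-1) `^ lambda * edist y z `^ lambda)) ->
  (forall y z, N * edist y z `^ lambda <= 2 `^ lambda * (u y + u z)) ->
  exists (a : Rn R m) (r : R), 0 < r /\
    tame lambda profile_lower profile_upper 1
      (fun y => u (affine_tuple a r y) / (N * r `^ lambda)).
Proof.
move=> mu_ N0 d0 du um uN.
have [a ua] := near_minimizer d0 du.
have u0 y : 0 < u y by exact: lt_le_trans (du y).
pose r := (u a / N) `^ lambda^-1.
have uaN : 0 < u a / N by rewrite divr_gt0.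
have r0 : 0 < r by rewrite powR_gt0.
have rl : r `^ lambda = u a / N.
  by rewrite -powRrM mulVf ?gt_eqF// powRr1// ltW.
have Nr : N * r `^ lambda = u a by rewrite rl mulrC divfK// gt_eqF.
exists a, r; split => //.
have da y : N * edist a (affine_tuple a r y) `^ lambda = u a * edist y (origin R m) `^ lambda.
  have {1}-> : a = affine_tuple a r (origin R m).
    by apply: eq_from_tnth => i; rewrite !tnth_mktuple mulr0 addr0.
  rewrite edist_affine_tuple ?(ltW r0)// edistC powRM ?(ltW r0) ?edist_ge0//.
  by rewrite mulrA Nr.
have P0 : 0 < 2 `^ lambda :> R by rewrite powR_gt0.
split.
- apply: measurable_funM => //.
  by apply: (measurableT_comp mu_); exact: measurable_affine_tuple.
- move=> y; have w0 := weight_gt0 y.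
  have e0 := edist_ge0 y (origin R m).
  set D := edist y (origin R m) `^ lambda in da *.
  have D0 : 0 <= D by exact: powR_ge0.
  have wD : weight y `^ lambda <= 2 `^ lambda * (1 + D).
    have := powRD_le2 (ltW lam0) ler01 e0; by rewrite powR1.
  have w1 : 1 <= weight y `^ lambda.
    rewrite -(powRr0 (weight y)); apply: ler_powR; last exact: ltW.
    exact: weight_ge1.
  have Dw : D <= weight y `^ lambda.
    apply: ge0_ler_powR; rewrite ?nnegrE ?(ltW lam0) ?(ltW w0)//.
    by rewrite lerDr.
  rewrite Nr; apply/andP; split.
    rewrite ler_pdivlMr// /profile_lower.
    have h := uN a (affine_tuple a r y); rewrite da -/D in h.
    have h2 := ua (affine_tuple a r y).
    have X0 : 0 < 3 * 2 `^ lambda + 2 :> R by lra.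
    have -> : 2 `^ (- lambda) / (3 * 2 `^ lambda + 2) * weight y `^ lambda * u a =
      u a * (2 `^ (- lambda) * weight y `^ lambda) / (3 * 2 `^ lambda + 2) by ring.
    rewrite ler_pdivrMr//; apply: (@le_trans _ _ (u a * (1 + D))).
      by rewrite ler_pM2l// powRN ler_pdivrMl.
    have h3 : 2 `^ lambda * (u a + u (affine_tuple a r y)) <=
        2 `^ lambda * (3 * u (affine_tuple a r y)) by rewrite ler_pM2l//; lra.
    lra.
  rewrite ler_pdivrMr//.
  have h := um 1 (affine_tuple a r y) a ltr01.
  rewrite invr1 (edistC _ a) [N * _]mulrCA da -/D in h.
  apply: le_trans h _; rewrite /profile_upper.
  have : u a * (1 + D) <= u a * (2 * weight y `^ lambda) by rewrite ler_pM2l//; lra.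
  move/(ler_wpM2l (ltW P0)); have -> : 1 + 1 = 2 :> R by ring.
  lra.
- move=> eta y z eta0; rewrite Nr ler_pdivrMr//.
  have := um eta (affine_tuple a r y) (affine_tuple a r z) eta0.
  rewrite edist_affine_tuple ?(ltW r0)// powRM ?(ltW r0) ?edist_ge0//.
  move=> /le_trans; apply; rewrite le_eqVlt; apply/orP; left; apply/eqP.
  rewrite rl; field; rewrite !gt_eqF//.
Qed.

End affine_normalization.

Section mass_normalization.
Context (R : realType) (m : nat).
Notation LY := (lebesgue_tuple R m).
Variables (lambda gam : R).
Hypothesis m0 : (0 < m)%N.
Hypothesis lam0 : 0 < lambda.
Hypothesis gam1 : 1 < gam.
Hypothesis lamgam : m%:R < lambda * (gam - 1).

Definition weight_mass : R := fine (\int[LY]_y (weight y `^ (- (lambda * (gam - 1))))%:E).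

Lemma weight_massE :
  (\int[LY]_y (weight y `^ (- (lambda * (gam - 1))))%:E)%E = weight_mass%:E.
Proof.
rewrite /weight_mass fineK// ge0_fin_numE; first exact: integral_weight_lty.
by apply: integral_ge0 => y _; rewrite lee_fin powR_ge0.
Qed.

Lemma weight_mass_gt0 : 0 < weight_mass.
Proof.
have mR : 0 <= m%:R :> R by [].
rewrite -lte_fin -weight_massE.
pose k : R := (1 + m%:R) `^ (- (lambda * (gam - 1))).
have k0 : 0 < k by rewrite powR_gt0//; lra.
apply: (@lt_le_trans _ _ k%:E); first by rewrite lte_fin.
apply: (@le_trans _ _ (\int[LY]_(y in cube (R := R) (m := m) 0) (cst k%:E) y)%E).
  rewrite integral_cst; last exact: measurable_cube.
  by have /= -> := @lebesgue_cube R m 0; rewrite mule1.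
have mw : measurable_fun [set: Rn R m] (fun y => (weight y `^ (- (lambda * (gam - 1))))%:E).
  by apply/measurable_EFinP; exact: measurable_weight_powR.
apply: (@le_trans _ _ (\int[LY]_(y in cube (R := R) (m := m) 0) (weight y `^ (- (lambda * (gam - 1))))%:E)%E).
  apply: ge0_le_integral => //.
  - exact: measurable_cube.
  - by move=> y _; rewrite lee_fin ltW.
  - exact: measurable_funTS.
  - move=> y y0; rewrite lee_fin /k !powRN.
    have w0 := weight_gt0 y.
    have := weight_cube_le (lexx 0) y0; rewrite add0r mulr1 => wy.
    have lg : 0 <= lambda * (gam - 1) by exact: le_trans (ltW lamgam).
    have m1 : 0 < 1 + m%:R :> R by lra.
    rewrite lef_pV2 ?posrE ?powR_gt0//.
    by apply: ge0_ler_powR; rewrite ?nnegrE//; lra.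
apply: ge0_subset_integral => //; first exact: measurable_cube.
by move=> y _; rewrite lee_fin powR_ge0.
Qed.

(** The mass of a candidate of profile [c, C] lies between the masses of its two
    bounds, so the factor [k] normalizing it is under control, with constants that
    do not depend on [v]. *)
Lemma mass_normalization (c C : R) (v : Rn R m -> R) : 0 < c -> 0 < C ->
  tame lambda c C 1 v ->
  let w := weight_mass `^ (gam - 1)^-1 in
  exists2 k, 0 < k & normalized lambda gam (w / C * c) (w / c * C) (w / c) (fun y => k * v y).
Proof.
move=> c0 C0 tv w; have g0 : 0 < gam - 1 by rewrite subr_gt0.
have ig0 : 0 < (gam - 1)^-1 by rewrite invr_gt0.
have v0 y : 0 < v y by exact: (tame_gt0 c0 tv y).
have mc : measurable_fun [set: Rn R m] (fun y => (cand (gam - 1) v y)%:E).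
  by apply/measurable_EFinP; exact: measurable_cand tv.
have mw : measurable_fun [set: Rn R m] (fun y => (weight y `^ (- (lambda * (gam - 1))))%:E).
  by apply/measurable_EFinP; exact: measurable_weight_powR.
have cst_int (k : R) : 0 <= k ->
   (\int[LY]_y (k * weight y `^ (- (lambda * (gam - 1))))%:E = (k * weight_mass)%:E)%E.
  move=> k0; under eq_integral do rewrite EFinM.
  rewrite ge0_integralZl//; last by move=> y _; rewrite lee_fin powR_ge0.
  by rewrite weight_massE.
pose I := (\int[LY]_y (cand (gam - 1) v y)%:E)%E.
have Ile : (I <= (c `^ (- (gam - 1)) * weight_mass)%:E)%E.
  rewrite -cst_int ?powR_ge0//; apply: ge0_le_integral => //.
  - by move=> y _; rewrite lee_fin powR_ge0.
  - by apply/measurable_EFinP; apply: measurable_funM => //; exact: measurable_weight_powR.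
  - by move=> y _; rewrite lee_fin; exact: (cand_le g0 c0 tv).
have Ige : ((C `^ (- (gam - 1)) * weight_mass)%:E <= I)%E.
  rewrite -cst_int ?powR_ge0//; apply: ge0_le_integral => //.
  - by move=> y _; rewrite lee_fin mulr_ge0 ?powR_ge0.
  - by apply/measurable_EFinP; apply: measurable_funM => //; exact: measurable_weight_powR.
  - by move=> y _; rewrite lee_fin; exact: (cand_ge g0 c0 C0 tv).
have Ifin : I \is a fin_num.
  rewrite ge0_fin_numE; first by apply: le_lt_trans Ile _; rewrite ltry.
  by apply: integral_ge0 => y _; rewrite lee_fin powR_ge0.
have W0 := weight_mass_gt0.
move: Ile Ige; rewrite -(fineK Ifin) !lee_fin; set i := fine I => Ile Ige.
have i0 : 0 < i by apply: lt_le_trans Ige; rewrite mulr_gt0 ?powR_gt0.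
have E (t : R) : 0 < t -> (t `^ (- (gam - 1)) * weight_mass) `^ (gam - 1)^-1 = w / t.
  move=> t0; rewrite powRM ?powR_ge0 ?(ltW W0)// -powRrM mulNr mulfV ?gt_eqF//.
  by rewrite powR_inv1 ?(ltW t0)// mulrC.
pose k := i `^ (gam - 1)^-1.
have kle : k <= w / c.
  rewrite -E//; apply: ge0_ler_powR => //; rewrite ?nnegrE ?(ltW ig0) ?(ltW i0)//.
  exact: mulr_ge0 (powR_ge0 _ _) (ltW W0).
have kge : w / C <= k.
  rewrite -E//; apply: ge0_ler_powR => //; rewrite ?nnegrE ?(ltW ig0) ?(ltW i0)//.
  exact: mulr_ge0 (powR_ge0 _ _) (ltW W0).
have k0 : 0 < k by rewrite powR_gt0.
exists k => //; split; last first.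
  have -> : (fun y => (cand (gam - 1) (fun y => k * v y) y)%:E) =
      (fun y => (k `^ (- (gam - 1)))%:E * (cand (gam - 1) v y)%:E)%E.
    by apply/funext => y; rewrite -EFinM /cand powRM ?(ltW k0) ?(ltW (v0 y)).
  rewrite ge0_integralZl//; last 2 first.
  - by move=> y _; rewrite lee_fin powR_ge0.
  - by rewrite lee_fin powR_ge0.
  rewrite -/I -(fineK Ifin) -/i -EFinM /k -powRrM mulrN mulVf ?gt_eqF//.
  by rewrite powR_inv1 ?(ltW i0)// mulVf ?gt_eqF.
have w0 : 0 <= w by exact: powR_ge0.
clear E Ile Ige W0 mc cst_int Ifin; clearbody k w.
have [mv vb vm] := tv; split.
- exact: measurable_funM.
- move=> y; have /andP[h1 h2] := vb y; have P0 := powR_gt0 lambda (weight_gt0 y).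
  rewrite -!mulrA; apply/andP; split.
    rewrite mulrA; apply: ler_pM => //.
    - by rewrite divr_ge0 ?(ltW C0).
    - by rewrite mulr_ge0 ?(ltW c0) ?(ltW P0).
  by rewrite [leRHS]mulrA; apply: ler_pM => //; exact: ltW.
- move=> eta y z eta0; have h := vm eta y z eta0.
  have X0 : 0 <= (1 + eta^-1) `^ lambda * edist y z `^ lambda by rewrite mulr_ge0 ?powR_ge0.
  apply: (@le_trans _ _ (k * ((1 + eta) `^ lambda * v z +
     1 * ((1 + eta^-1) `^ lambda * edist y z `^ lambda)))).
    by rewrite ler_pM2l.
  rewrite mulrDr mul1r mulrCA lerD2l.
  by rewrite ler_wpM2r.
Qed.

End mass_normalization.

(** * Invariance under dilations; potentials of bounded densities *)

Lemma eq_mulEFin_inv (R : realType) (c t : R) (x y : \bar R) : 0 < c ->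
  (t%:E * x = c^-1%:E * y)%E -> y = ((c * t)%:E * x)%E.
Proof.
move=> c0 E; rewrite EFinM -muleA E muleA -EFinM mulfV ?gt_eqF// mul1e.
by [].
Qed.

Section dilation.
Context (R : realType) (m : nat).
Notation LX := (lebesgue_tuple R m.+1).
Notation LY := (lebesgue_tuple R m).
Notation D := (half_space R m.+1).
Notation bd := (@boundary_point R m.+1).
Variables (lambda beta : R).
Let T := transform LY (hs_kernel (m := m) lambda beta).

Lemma nth_last_affine (a : Rn R m) (r : R) (x : Rn R m.+1) :
  ((affine_tuple (bd a) r x)`_m : R) = r * x`_m.
Proof. by rewrite !nth_last_tnth tnth_mktuple tnth_boundary_max add0r. Qed.

Lemma transform_dilation (a : Rn R m) (r : R) (f : Rn R m -> R) (x : Rn R m.+1) :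
  0 < r -> D x -> measurable_fun [set: Rn R m] f -> (forall y, 0 <= f y) ->
  T f (affine_tuple (bd a) r x) =
  ((r ^+ m * (r `^ beta * r `^ lambda))%:E * T (f \o affine_tuple a r) x)%E.
Proof.
move=> r0 Dx mf f0; have x0 : 0 < (x`_m : R) := Dx.
have rm : 0 < r ^+ m by rewrite exprn_gt0.
have mK z : measurable_fun [set: Rn R m] (hs_kernel lambda beta z).
  exact: (measurable_kernel_section (@measurable_hs_kernel R m lambda beta)).
pose h y := (hs_kernel lambda beta (affine_tuple (bd a) r x) y * f y)%:E.
have mh : measurable_fun [set: Rn R m] h.
  by apply/measurable_EFinP; exact: measurable_funM.
have h0 y : (0 <= h y)%E by rewrite lee_fin mulr_ge0 ?hs_kernel_ge0.
have := integral_affine_tuple a r0 mh h0.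
have -> : (\int[LY]_y h (affine_tuple a r y) =
    (r `^ beta * r `^ lambda)%:E * T (f \o affine_tuple a r) x)%E.
  rewrite /T /transform -ge0_integralZl//; last 3 first.
  - apply/measurable_EFinP; apply: measurable_funM; first exact: mK.
    exact: (measurableT_comp mf (measurable_affine_tuple a r)).
  - by move=> y _; rewrite lee_fin mulr_ge0 ?hs_kernel_ge0//=.
  - by rewrite lee_fin mulr_ge0 ?powR_ge0.
  apply: eq_integral => y _; rewrite -EFinM; congr (_%:E).
  rewrite /hs_kernel nth_last_affine -boundary_point_affine.
  rewrite edist_affine_tuple ?(ltW r0)//.
  by rewrite !powRM ?edist_ge0 ?(ltW r0) ?(ltW x0)//=; ring.
rewrite -/(T f (affine_tuple (bd a) r x)) => E.
rewrite EFinM -muleA [X in (_ * X)%E]E muleA -EFinM mulfV ?gt_eqF// mul1e.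
by [].
Qed.

Lemma half_space_affine (a : Rn R m) (r : R) (x : Rn R m.+1) : 0 < r ->
  D (affine_tuple (bd a) r x) <-> D x.
Proof. by move=> r0; rewrite /half_space/= nth_last_affine pmulr_rgt0. Qed.

Lemma epowZ (s : R) (t : \bar R) (q : R) : 0 < s -> (0 < t)%E -> t \is a fin_num ->
  epow (s%:E * t)%E q = ((s `^ q)%:E * epow t q)%E.
Proof.
move=> s0; case: t => [t| |]// t0 _; rewrite lte_fin in t0.
by rewrite -EFinM !epow_EFin ?mulr_gt0// powRM ?(ltW s0) ?(ltW t0)// EFinM.
Qed.

(** Applied with [rho = r `^ (- (m / p))], the factor in front of the energy on the
    right is [1]: this is the scaling relation between [p] and [q]. *)
Lemma energy_dilation (q : R) (a : Rn R m) (r rho : R) (f F : Rn R m -> R) :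
  0 < r -> 0 < rho ->
  measurable_fun [set: Rn R m] f -> (forall y, 0 <= f y) ->
  measurable_fun [set: Rn R m] F -> (forall y, 0 <= F y) ->
  (forall y, f (affine_tuple a r y) = rho * F y) ->
  (forall x, D x -> (0 < T F x)%E /\ T F x \is a fin_num) ->
  energy lambda beta q f =
  ((r ^+ m.+1 * (r ^+ m * (r `^ beta * r `^ lambda) * rho) `^ q)%:E *
    energy lambda beta q F)%E.
Proof.
move=> r0 rho0 mf f0 mF F0 fF TF.
have mE (g : Rn R m -> R) : measurable_fun [set: Rn R m] g -> (forall y, 0 <= g y) ->
    measurable_fun [set: Rn R m.+1] (fun x => epow (T g x) q).
  move=> mg g0; apply: (measurableT_comp (measurable_epow _)).
  apply: measurable_transform => //; last by move=> *; exact: hs_kernel_ge0.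
  exact: measurable_hs_kernel.
pose s := r ^+ m * (r `^ beta * r `^ lambda) * rho.
have s0 : 0 < s by rewrite !mulr_gt0 ?powR_gt0 ?exprn_gt0.
have rm1 : 0 < r ^+ m.+1 by rewrite exprn_gt0.
pose h := (fun x => epow (T f x) q) \_ D.
have mh : measurable_fun [set: Rn R m.+1] h.
  apply/(measurable_restrictT _ _).1; first exact: measurable_half_space.
  by apply: measurable_funTS; exact: mE.
have h0 x : (0 <= h x)%E by apply: erestrict_ge0 => z _; exact: epow_ge0.
have E := integral_affine_tuple (bd a) r0 mh h0.
have E1 : (\int[LX]_x h (affine_tuple (bd a) r x) =
    (s `^ q)%:E * energy lambda beta q F)%E.
  rewrite /energy -ge0_integralZl//; last 4 first.
  - exact: measurable_half_space.
  - by apply: measurable_funTS; exact: mE.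
  - by move=> x _; exact: epow_ge0.
  - by rewrite lee_fin powR_ge0.
  rewrite [RHS]integral_mkcond; apply: eq_integral => x _.
  rewrite /h !patchE.
  have -> : (affine_tuple (bd a) r x \in D) = (x \in D).
    by apply/idP/idP; rewrite !inE => /(half_space_affine a x r0).
  case: ifPn => // /[1!inE] Dx.
  have [T0 Tf] := TF _ Dx.
  rewrite transform_dilation//.
  have -> : T (f \o affine_tuple a r) x = (rho%:E * T F x)%E.
    rewrite /T /transform -ge0_integralZl//; last 3 first.
    - apply/measurable_EFinP; apply: measurable_funM => //.
      exact: (measurable_kernel_section (@measurable_hs_kernel R m lambda beta)).
    - by move=> y _; rewrite lee_fin mulr_ge0 ?hs_kernel_ge0.
    - by rewrite lee_fin ltW.
    by apply: eq_integral => y _; rewrite -EFinM /= fF; congr (_%:E); ring.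
  by rewrite muleA -EFinM epowZ.
have E2 : (\int[LX]_x h x = energy lambda beta q f)%E by rewrite /energy [RHS]integral_mkcond.
have {}E := etrans (esym E1) (etrans E (congr1 _ E2)).
exact: eq_mulEFin_inv rm1 E.
Qed.

End dilation.

Section potential_of_a_bounded_set.
Context (R : realType) (m : nat).
Notation LX := (lebesgue_tuple R m.+1).
Notation LY := (lebesgue_tuple R m).
Notation bd := (@boundary_point R m.+1).
Variables (lambda beta : R).
Hypothesis lam0 : 0 < lambda.
Hypothesis beta0 : 0 <= beta.
Variables (A : set (Rn R m.+1)) (k : R) (g : Rn R m.+1 -> R) (g1 g2 : R).
Hypothesis mA : measurable A.
Hypothesis k1 : 1 <= k.
Hypothesis Ak : forall x : Rn R m.+1, A x -> k^-1 <= (x`_m : R) /\ edist x (origin R m.+1) <= k.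
Hypothesis A0 : (0 < LX A)%E.
Hypothesis mg : measurable_fun [set: Rn R m.+1] g.
Hypothesis g10 : 0 < g1.
Hypothesis gA : forall x, A x -> g1 <= g x <= g2.
Hypothesis gN : forall x, ~ A x -> g x = 0.

Let g0 x : 0 <= g x.
Proof.
have [/gA/andP[h _]|/gN ->//] := pselect (A x).
by apply: le_trans h; exact: ltW.
Qed.

Lemma bounded_set_lty : (LX A < +oo)%E.
Proof.
pose B := [set x : Rn R m.+1 | forall i, (`[- k, k]%classic : set (measurableTypeR R)) (tnth x i)].
have mB : measurable B.
  rewrite (_ : B = \bigcap_(i in [set: 'I_m.+1])
      ((fun x : Rn R m.+1 => tnth x i : R) @^-1` `[- k, k])).
    apply: fin_bigcap_measurable => // i _.
    by rewrite -[X in measurable X]setTI; exact: measurable_tnth_R.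
  by apply/seteqP; split => x /= Bx i *; exact: Bx.
apply: (@le_lt_trans _ _ (LX B)).
  apply: le_measure; rewrite ?inE//.
  move=> x Ax i; have [_ xk] := Ak Ax; rewrite /= in_itv/= -ler_norml.
  apply: le_trans xk; apply: le_trans (le_edist_tnth x (origin R m.+1) i).
  by rewrite tnth_mktuple subr0.
rewrite [X in (X < _)%E](@lebesgue_tuple_box R m.+1 (fun=> `[- k, k]%classic))//.
under eq_bigr do rewrite lebesgue_measure_itv/= lte_fin.
have k0 : 0 < k := lt_le_trans ltr01 k1.
have -> : - k < k by rewrite -subr_gt0 opprK addr_gt0.
by rewrite -EFinB prodEFin ltry.
Qed.

Let integral_cst_A (c : R) : (\int[LX]_(x in A) (cst c%:E) x = c%:E * LX A)%E.
Proof. exact: integral_cst. Qed.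

Let toA (h : Rn R m.+1 -> R) :
  (\int[LX]_x (h x * g x)%:E = \int[LX]_(x in A) (h x * g x)%:E)%E.
Proof.
rewrite [RHS]integral_mkcond; apply: eq_integral => x _; rewrite patchE.
by case: ifPn => // /negP; rewrite inE => /gN ->; rewrite mulr0.
Qed.

Let g2_ge0 : 0 <= g2.
Proof.
have [[x Ax]|/forallNP nA] := pselect (exists x, A x).
  by have /andP[h1 h2] := gA Ax; apply: le_trans (le_trans _ h1) h2; exact: ltW.
suff A00 : A = set0 by move: A0; rewrite A00 measure0 ltxx.
by apply/seteqP; split => x // /nA.
Qed.

Lemma integral_density_lty (h : Rn R m.+1 -> R) (B : R) :
  measurable_fun [set: Rn R m.+1] h -> (forall x, A x -> 0 <= h x <= B) ->
  (\int[LX]_x (h x * g x)%:E < +oo)%E.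
Proof.
move=> mh hB; rewrite toA; apply: (@le_lt_trans _ _ (\int[LX]_(x in A) (cst (B * g2)%:E) x)%E).
  apply: ge0_le_integral => //.
  - by move=> x Ax; have /andP[h0 _] := hB _ Ax; rewrite lee_fin mulr_ge0.
  - by apply/measurable_EFinP/measurable_funTS; exact: measurable_funM.
  - by move=> x Ax; have /andP[h0 h1] := hB _ Ax; have /andP[_ ?] := gA Ax; rewrite lee_fin ler_pM.
rewrite integral_cst_A; have := bounded_set_lty; case: (LX A) A0 => [t| |]// _ _.
by rewrite -EFinM ltry.
Qed.

Lemma integral_density_gt0 (h : Rn R m.+1 -> R) (B : R) : 0 < B ->
  measurable_fun [set: Rn R m.+1] h -> (forall x, A x -> B <= h x) ->
  (0 < \int[LX]_x (h x * g x)%:E)%E.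
Proof.
move=> B0 mh hB; rewrite toA; apply: (@lt_le_trans _ _ (\int[LX]_(x in A) (cst (B * g1)%:E) x)%E).
  by rewrite integral_cst_A mule_gt0// lte_fin mulr_gt0.
apply: ge0_le_integral => //.
- by move=> x _; rewrite lee_fin mulr_ge0 ?ltW.
- by apply/measurable_EFinP/measurable_funTS; exact: measurable_funM.
- move=> x Ax; have Bh := hB _ Ax; have /andP[? _] := gA Ax.
  by rewrite lee_fin ler_pM// ltW.
Qed.

(** Pointwise linear inequalities between kernels are inherited by their
    potentials. *)
Lemma integral_density_le (h1 h2 h3 : Rn R m.+1 -> R) (a b : R) : 0 <= a -> 0 <= b ->
  measurable_fun [set: Rn R m.+1] h1 -> measurable_fun [set: Rn R m.+1] h2 ->
  measurable_fun [set: Rn R m.+1] h3 ->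
  (forall x, 0 <= h1 x) -> (forall x, 0 <= h2 x) -> (forall x, 0 <= h3 x) ->
  (forall x, A x -> h1 x <= a * h2 x + b * h3 x) ->
  (\int[LX]_x (h1 x * g x)%:E <=
   a%:E * \int[LX]_x (h2 x * g x)%:E + b%:E * \int[LX]_x (h3 x * g x)%:E)%E.
Proof.
move=> a0 b0 mh1 mh2 mh3 h10 h20 h30 H.
have mM (h : Rn R m.+1 -> R) : measurable_fun [set: Rn R m.+1] h ->
    measurable_fun [set: Rn R m.+1] (fun x => (h x * g x)%:E).
  by move=> mh; apply/measurable_EFinP; exact: measurable_funM.
have M0 (h : Rn R m.+1 -> R) : (forall x, 0 <= h x) -> forall x, (0 <= (h x * g x)%:E)%E.
  by move=> h0 x; rewrite lee_fin mulr_ge0.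
rewrite -ge0_integralZl//; [|exact: mM|by move=> x _; exact: M0].
rewrite -ge0_integralZl//; [|exact: mM|by move=> x _; exact: M0].
rewrite -ge0_integralD//; first last.
- by apply: measurable_funeM; exact: mM.
- by move=> x _; rewrite mule_ge0 ?lee_fin// mulr_ge0.
- by apply: measurable_funeM; exact: mM.
- by move=> x _; rewrite mule_ge0 ?lee_fin// mulr_ge0.
apply: ge0_le_integral => //.
- by move=> x _; exact: M0.
- exact: mM.
- by apply: emeasurable_funD; apply: measurable_funeM; exact: mM.
move=> x _; rewrite -!EFinM -EFinD lee_fin.
have [Ax|/gN ->] := pselect (A x); last by rewrite !mulr0 addr0.
by rewrite !mulrA -mulrDl ler_wpM2r// H.
Qed.

(** The density [g] lives on a bounded set away from the boundary of the
    half-space, so its potential [u] is finite, and bounded below because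
    [|x - y| >= x_n] there. *)
Lemma potential_normalization : exists (u : Rn R m -> R) (N r : R) (z : Rn R m),
  [/\ 0 < N /\ 0 < r, measurable_fun [set: Rn R m] u /\ (forall y, 0 < u y),
  (forall y, \int[LX]_x (hs_kernel lambda beta x y * g x)%:E = (u y)%:E)%E &
  tame lambda (profile_lower lambda) (profile_upper lambda) 1
      (fun y => u (affine_tuple z r y) / (N * r `^ lambda))].
Proof.
have k0 : 0 < k := lt_le_trans ltr01 k1.
have ik0 : 0 < k^-1 by rewrite invr_gt0.
have xA x : A x -> 0 < (x`_m : R) <= k.
  move=> Ax; have [h1 h2] := Ak Ax; rewrite (lt_le_trans ik0 h1)/=.
  apply: le_trans h2; have := le_last_edist_boundary x (origin R m).
  by rewrite boundary_point_origin.
have mK y : measurable_fun [set: Rn R m.+1] (fun x => hs_kernel lambda beta x y).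
  exact: (measurable_kernel_section2 (@measurable_hs_kernel R m lambda beta)).
have mX s : measurable_fun [set: Rn R m.+1] (fun x : Rn R m.+1 => (x`_m : R) `^ s).
  by apply: (measurableT_comp (measurable_powR _)); exact: measurable_nth_last.
pose Ue y := (\int[LX]_x (hs_kernel lambda beta x y * g x)%:E)%E.
have K0 x y := @hs_kernel_ge0 R m lambda beta x y.
have Ue0 y : (0 <= Ue y)%E by apply: integral_ge0 => x _; rewrite lee_fin mulr_ge0.
have Kup y x : A x -> 0 <= hs_kernel lambda beta x y <= k `^ beta * ((1 + k) * weight y) `^ lambda.
  move=> Ax; have /andP[x0 xk] := xA _ Ax; have [_ h2] := Ak Ax.
  rewrite K0/=; apply: ler_pM; rewrite ?powR_ge0//.
    by apply: ge0_ler_powR; rewrite ?nnegrE// ltW.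
  have wy := weight_gt0 y.
  apply: ge0_ler_powR; rewrite ?nnegrE ?edist_ge0 ?(ltW lam0)//.
    by rewrite mulr_ge0// ?ltW//; lra.
  apply: le_trans (edist_boundary_le_weight x y) _.
  by rewrite ler_wpM2r ?(ltW wy)// /weight lerD2l.
have Uefin y : Ue y \is a fin_num.
  by rewrite ge0_fin_numE//; apply: integral_density_lty (mK y) (Kup y).
pose u y := fine (Ue y).
have uE y : Ue y = (u y)%:E by rewrite fineK.
pose Ne := (\int[LX]_x ((x`_m : R) `^ beta * g x)%:E)%E.
have Xb s : 0 <= s -> forall x : Rn R m.+1, A x -> 0 <= (x`_m : R) `^ s <= k `^ s.
  move=> s0 x Ax; have /andP[x0 xk] := xA _ Ax; rewrite powR_ge0/=.
  by apply: ge0_ler_powR; rewrite ?nnegrE// ltW.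
have Xl s : 0 <= s -> forall x : Rn R m.+1, A x -> k^-1 `^ s <= (x`_m : R) `^ s.
  move=> s0 x Ax; have /andP[x0 xk] := xA _ Ax; have [h1 _] := Ak Ax.
  by apply: ge0_ler_powR; rewrite ?nnegrE// ltW.
have fin_pos s : 0 <= s -> exists2 t : R, 0 < t &
    (\int[LX]_x ((x`_m : R) `^ s * g x)%:E)%E = t%:E.
  move=> s0; have lty := integral_density_lty (mX s) (Xb _ s0).
  have gt0 := integral_density_gt0 (powR_gt0 s ik0) (mX s) (Xl _ s0).
  by case: (\int[LX]_x _)%E lty gt0 => [t| |]// _ t0; exists t.
have [N N0 NE] := fin_pos beta beta0.
have NeE : Ne = N%:E := NE.
have bl0 : 0 <= beta + lambda by rewrite addr_ge0// ltW.
have [d d0 dE] := fin_pos _ bl0.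
have du y : d <= u y.
  rewrite -lee_fin -uE -dE.
  have -> : (\int[LX]_x ((x`_m : R) `^ (beta + lambda) * g x)%:E =
     \int[LX]_(x in A) ((x`_m : R) `^ (beta + lambda) * g x)%:E)%E by exact: (toA (fun x : Rn R m.+1 => (x`_m : R) `^ (beta + lambda))).
  rewrite /Ue toA; apply: ge0_le_integral => //.
  - by move=> x _; rewrite lee_fin mulr_ge0 ?powR_ge0.
  - by apply/measurable_EFinP/measurable_funTS; apply: measurable_funM.
  - by apply/measurable_EFinP/measurable_funTS; apply: measurable_funM.
  move=> x Ax; have /andP[x0 xk] := xA _ Ax.
  rewrite lee_fin ler_wpM2r// powRD; last by apply/implyP => _; rewrite gt_eqF.
  rewrite ler_wpM2l ?powR_ge0//.
  apply: ge0_ler_powR; rewrite ?nnegrE ?edist_ge0 ?(ltW lam0) ?(ltW x0)//.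
  exact: le_last_edist_boundary.
have u0 y : 0 < u y by exact: lt_le_trans (du y).
have mu_ : measurable_fun [set: Rn R m] u.
  apply: measurableT_comp => //.
  apply: (measurable_fun_fubini_tonelli_G
    (fun z : Rn R m.+1 * Rn R m => (hs_kernel lambda beta z.1 z.2 * g z.1)%:E)).
    apply/measurable_EFinP; apply: measurable_funM; first exact: measurable_hs_kernel.
    exact: (measurableT_comp mg).
  by move=> z; rewrite lee_fin mulr_ge0.
have um eta y z : 0 < eta -> u y <= (1 + eta) `^ lambda * u z +
    N * ((1 + eta^-1) `^ lambda * edist y z `^ lambda).
  move=> eta0.
  have H : (Ue y <= ((1 + eta) `^ lambda)%:E * Ue z +
      ((1 + eta^-1) `^ lambda * edist y z `^ lambda)%:E * Ne)%E; last first.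
    by move: H; rewrite !uE NeE -!EFinM -EFinD lee_fin (mulrC _ N).
  apply: integral_density_le; [|..|by move=> x; exact: powR_ge0|];
    rewrite ?mulr_ge0 ?powR_ge0//.
  move=> x Ax; rewrite /hs_kernel.
  have -> : (1 + eta) `^ lambda * ((x`_m : R) `^ beta * edist x (bd z) `^ lambda) +
      (1 + eta^-1) `^ lambda * edist y z `^ lambda * (x`_m : R) `^ beta =
      (x`_m : R) `^ beta * ((1 + eta) `^ lambda * edist x (bd z) `^ lambda +
        (1 + eta^-1) `^ lambda * edist y z `^ lambda) by ring.
  rewrite ler_wpM2l ?powR_ge0//.
  apply: le_trans (powRD_le (ltW lam0) eta0 (edist_ge0 _ _) (edist_ge0 _ _)).
  apply: ge0_ler_powR; rewrite ?nnegrE ?addr_ge0 ?edist_ge0 ?(ltW lam0)//.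
  apply: le_trans (edist_triangle x (bd z) (bd y)) _.
  by rewrite edist_boundary_point (edistC z).
have uN y z : N * edist y z `^ lambda <= 2 `^ lambda * (u y + u z).
  have H : (\int[LX]_x ((edist y z `^ lambda * (x`_m : R) `^ beta) * g x)%:E <=
      (2 `^ lambda)%:E * Ue y + (2 `^ lambda)%:E * Ue z)%E; last first.
    have E : ((edist y z `^ lambda)%:E * Ne =
      \int[LX]_x ((edist y z `^ lambda * (x`_m : R) `^ beta) * g x)%:E)%E; last first.
      have {H} := eq_ind_r (fun t => (t <= _)%E) H E.
      rewrite NeE (uE y) (uE z) => H.
      rewrite -lee_fin mulrDr mulrC.
      exact: H.
    rewrite /Ne -ge0_integralZl//; last 3 first.
    - by apply/measurable_EFinP; exact: measurable_funM.
    - by move=> x _; rewrite lee_fin mulr_ge0 ?powR_ge0.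
    - by rewrite lee_fin powR_ge0.
    by apply: eq_integral => x _; rewrite -EFinM mulrA.
  apply: integral_density_le; rewrite ?powR_ge0//.
  - by apply: measurable_funM.
  - by move=> x; rewrite mulr_ge0 ?powR_ge0.
  move=> x Ax; rewrite /hs_kernel -mulrDr -mulrDr mulrC mulrCA ler_wpM2l ?powR_ge0//.
  apply: le_trans (powRD_le2 (ltW lam0) (edist_ge0 _ _) (edist_ge0 _ _)).
  apply: ge0_ler_powR; rewrite ?nnegrE ?addr_ge0 ?edist_ge0 ?(ltW lam0)//.
  have := edist_triangle (bd y) x (bd z).
  by rewrite edist_boundary_point (edistC (bd y)).
have [z [r [r0 tr]]] := affine_normalization lam0 mu_ N0 d0 du um uN.
by exists u, N, r, z.
Qed.

End potential_of_a_bounded_set.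

(** * Reduction of an arbitrary function to the compact class *)

Section reduction.
Context (R : realType) (m : nat).
Notation LX := (lebesgue_tuple R m.+1).
Notation LY := (lebesgue_tuple R m).
Notation D := (half_space R m.+1).
Variables (lambda beta p q : R).
Hypothesis m0 : (0 < m)%N.
Hypothesis lam0 : 0 < lambda.
Hypothesis beta0 : 0 <= beta.
Hypothesis p01 : 0 < p < 1.
Hypothesis q0 : q < 0.
Let gam := (1 - p)^-1.
Hypothesis lamgam : m%:R < lambda * (gam - 1).
Hypothesis hom : q * (m%:R / p - (lambda + beta + m%:R)) = m.+1%:R.
Let T := transform LY (hs_kernel (m := m) lambda beta).

Let p0 : 0 < p. Proof. by case/andP : p01. Qed.
Let p1 : 0 < 1 - p. Proof. by case/andP : p01 => _; rewrite subr_gt0. Qed.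

Lemma conjugate_exponentE : gam * p = gam - 1.
Proof. by rewrite /gam; field; exact: lt0r_neq0. Qed.

Lemma conjugate_exponent_gt1 : 1 < gam.
Proof.
rewrite -subr_gt0 -conjugate_exponentE mulr_gt0// invr_gt0.
exact: p1.
Qed.

Let w := weight_mass m lambda gam `^ (gam - 1)^-1.
(** The class over which the energy is maximized is described by three constants
    depending only on the dimension and the exponents, not on the function one
    starts from. *)
Definition class_lower := w / profile_upper lambda * profile_lower lambda.
Definition class_upper := w / profile_lower lambda * profile_upper lambda.
Definition class_modulus := w / profile_lower lambda.

Lemma class_constants_gt0 : [/\ 0 < class_lower, 0 < class_upper & 0 < class_modulus].
Proof.
have w0 : 0 < w by rewrite powR_gt0// weight_mass_gt0// conjugate_exponent_gt1.
have l0 := profile_lower_gt0 lambda; have u0 := profile_upper_gt0 lambda.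
by split; rewrite ?mulr_gt0 ?divr_gt0 ?invr_gt0.
Qed.

(** Sets exhausting the part of the half-space where the transform is finite, on
    each of which all the quantities at play are bounded above and below. *)
Definition truncation (f : Rn R m -> R) (k : R) : set (Rn R m.+1) :=
  [set x : Rn R m.+1 | [/\ k^-1 <= (x`_m : R), edist x (origin R m.+1) <= k &
    (k^-1%:E <= T f x <= k%:E)%E]].

Variable f : Rn R m -> R.
Hypothesis mf : measurable_fun [set: Rn R m] f.
Hypothesis f0 : forall y, 0 <= f y.
Hypothesis fp : (\int[LY]_y ((f y) `^ p)%:E = 1)%E.

Let mT : measurable_fun [set: Rn R m.+1] (T f).
Proof.
apply: measurable_transform => //; last by move=> *; exact: hs_kernel_ge0.
exact: measurable_hs_kernel.
Qed.

Lemma measurable_truncation k : measurable (truncation f k).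
Proof.
rewrite (_ : truncation f k =
   ((fun x : Rn R m.+1 => x`_m : R) @^-1` `[k^-1, +oo[%classic) `&`
   (((fun x => edist x (origin R m.+1)) @^-1` `]-oo, k]%classic) `&`
    ((T f) @^-1` `[k^-1%:E, k%:E]%classic))).
  apply: measurableI; last apply: measurableI.
  - by rewrite -[X in measurable X]setTI; apply: measurable_nth_last.
  - by rewrite -[X in measurable X]setTI; apply: measurable_norm.
  - by rewrite -[X in measurable X]setTI; apply: mT => //; exact: emeasurable_itv.
apply/seteqP; split => x /=; rewrite /truncation/= !in_itv/= andbT.
  by move=> [].
by move=> [? [? ?]]; split.
Qed.

(** Improve [f] relatively to the truncated set, and bring the resulting potential
    to its normal form by a translation and a dilation; once the [p]-mass is
    normalized, this leaves the energy unchanged. *)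
Lemma truncation_reduction (k : R) : 1 <= k ->
  (0 < \int[LX]_(x in truncation f k) epow (T f x) q)%E ->
  exists2 u : Rn R m -> R, normalized lambda gam class_lower class_upper class_modulus u &
   (\int[LX]_(x in truncation f k) epow (T f x) q <= energy lambda beta q (cand gam u))%E.
Proof.
move=> k1; set A := truncation f k => I0.
have mA : measurable A by exact: measurable_truncation.
have k0 : 0 < k := lt_le_trans ltr01 k1.
have ik0 : 0 < k^-1 by rewrite invr_gt0.
pose b x := fine (T f x).
have mb : measurable_fun [set: Rn R m.+1] b by exact: measurableT_comp.
have bA x : A x -> T f x = (b x)%:E /\ k^-1 <= b x <= k.
  move=> [_ _]; rewrite /b; case: (T f x) => [t| |].
  - by rewrite !lee_fin => h; split.
  - by rewrite leye_eq/= andbF.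
  - by rewrite leeNy_eq.
have b0 x : A x -> 0 < b x.
  by move=> /bA[_ /andP[h _]]; exact: lt_le_trans h.
have IE : (\int[LX]_(x in A) epow (T f x) q = \int[LX]_(x in A) ((b x) `^ q)%:E)%E.
  apply: eq_integral => x /[1!inE] Ax; have [-> _] := bA _ Ax.
  by rewrite epow_EFin// b0.
have Ak (x : Rn R m.+1) : A x -> k^-1 <= (x`_m : R) /\ edist x (origin R m.+1) <= k.
  by move=> [].
have Ioo := bounded_set_lty mA k1 Ak.
have mbq s : measurable_fun [set: Rn R m.+1] (fun x => b x `^ s).
  exact: (measurableT_comp (measurable_powR _)).
have Icst : (\int[LX]_(x in A) ((b x) `^ q)%:E <= (k^-1 `^ q)%:E * LX A)%E.
  apply: (@le_trans _ _ (\int[LX]_(x in A) (cst (k^-1 `^ q)%:E) x)%E); last first.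
    by rewrite integral_cst.
  apply: ge0_le_integral => //.
  - by move=> x _; rewrite lee_fin powR_ge0.
  - by apply/measurable_EFinP/measurable_funTS.
  - move=> x Ax; have [_ /andP[h _]] := bA _ Ax.
    by rewrite lee_fin powR_antitone// ltW.
have A0 : (0 < LX A)%E.
  rewrite lt0e measure_ge0 andbT; apply/eqP => A0.
  by move: I0; rewrite IE ltNge => /negP; apply; move: Icst; rewrite A0 mule0.
pose g x := b x `^ (q - 1) * \1_A x.
have mg : measurable_fun [set: Rn R m.+1] g.
  by apply: measurable_funM => //; exact: measurable_indic.
have q1 : q - 1 <= 0 by rewrite subr_le0 (le_trans (ltW q0)).
have gA x : A x -> k `^ (q - 1) <= g x <= k^-1 `^ (q - 1).
  move=> Ax; have [_ /andP[h1 h2]] := bA _ Ax.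
  by rewrite /g indicE mem_set// mulr1 !powR_antitone// b0.
have gN x : ~ A x -> g x = 0 by move=> nA; rewrite /g indicE memNset// mulr0.
(* positive lower and upper bounds of the density [g] on [A]: [k `^ (q - 1)] and
   [k^-1 `^ (q - 1)] *)
have [u [N [r [z [[N0 r0] [mu_ u0] uE tv]]]]] :=
  potential_normalization lam0 beta0 mA k1 Ak A0 mg (powR_gt0 (q - 1) k0) gA gN.
have g1 := conjugate_exponent_gt1.
have [kap kap0 nF] := mass_normalization m0 g1 lamgam
  (profile_lower_gt0 lambda) (profile_upper_gt0 lambda) tv.
pose s := N * r `^ lambda; have s0 : 0 < s by rewrite mulr_gt0 ?powR_gt0.
set v := (fun y => kap * (u (affine_tuple z r y) / (N * r `^ lambda))) in nF.
exists v; first exact: nF.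
pose rho := r `^ (- (m%:R / p)).
have rho0 : 0 < rho by rewrite powR_gt0.
pose sigma := rho * (kap / s) `^ (- gam).
have sigma0 : 0 < sigma by rewrite mulr_gt0 ?powR_gt0 ?divr_gt0.
pose ft y := sigma * u y `^ (- gam).
have ftF y : ft (affine_tuple z r y) = rho * cand gam v y.
  rewrite /ft /sigma /cand /v -/s -mulrA; congr (_ * _).
  rewrite -powRM ?(ltW (u0 _)) ?divr_ge0 ?(ltW s0) ?(ltW kap0)//.
  by congr (_ `^ _); ring.
have [l0 c0 M0] := class_constants_gt0.
have [tF nF1] := nF.
have ft0 y : 0 < ft y by rewrite mulr_gt0 ?powR_gt0.
have mft : measurable_fun [set: Rn R m] ft.
  by apply: measurable_funM => //; apply: (measurableT_comp (measurable_powR _)).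
have rm0 : 0 < r ^+ m by rewrite exprn_gt0.
have pn0 : p != 0 by exact: lt0r_neq0.
have ftp : (\int[LY]_y ((ft y) `^ p)%:E = 1)%E.
  have mh : measurable_fun [set: Rn R m] (fun y => ((ft y) `^ p)%:E).
    by apply/measurable_EFinP; apply: (measurableT_comp (measurable_powR _)).
  have h0 y : (0 <= ((ft y) `^ p)%:E)%E by rewrite lee_fin powR_ge0.
  have E := integral_affine_tuple z r0 mh h0.
  have E1 : (\int[LY]_y ((ft (affine_tuple z r y)) `^ p)%:E = (r ^- m)%:E)%E.
    rewrite -[RHS]mule1 -nF1 -ge0_integralZl//; last 3 first.
    - by apply/measurable_EFinP; exact: measurable_cand tF.
    - by move=> y _; rewrite lee_fin powR_ge0.
    - by rewrite lee_fin invr_ge0 ltW.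
    apply: eq_integral => y _; rewrite -EFinM ftF; congr (_%:E).
    rewrite powRM ?(ltW rho0) ?powR_ge0// /cand -powRrM mulNr conjugate_exponentE.
    congr (_ * _); rewrite /rho -powRrM mulNr divfK//.
    by rewrite powRN powR_mulrn// ltW.
  have E2 : ((1 : R)%:E * (r ^- m)%:E = (r ^+ m)^-1%:E *
      \int[LY]_y ((ft y) `^ p)%:E)%E := etrans (mul1e _) (etrans (esym E1) E).
  rewrite (eq_mulEFin_inv rm0 E2) mulr1 -EFinM mulfV ?gt_eqF//.
have IAoo : (\int[LX]_(x in A) ((b x) `^ q)%:E < +oo)%E.
  apply: le_lt_trans Icst _.
  by case: (LX A) A0 Ioo => [t| |]// _ _; rewrite -EFinM ltry.
rewrite IE.
have := @transform_improvement _ _ _ _ R LX LY _ (@measurable_hs_kernel R m lambda beta)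
  (@hs_kernel_ge0 R m lambda beta) p q sigma f u A b p01 q0 sigma0 mf f0 fp mA mb b0
  (fun x Ax => (bA x Ax).1) IAoo mu_ u0 uE ftp.
move=> /le_trans; apply.
apply: (@le_trans _ _ (energy lambda beta q ft)).
  apply: ge0_subset_integral => //.
  - exact: measurable_half_space.
  - apply: measurable_funTS; apply: (measurableT_comp (measurable_epow _)).
    apply: measurable_transform; [exact: measurable_hs_kernel|
      exact: hs_kernel_ge0|exact: mft|by move=> y; exact/ltW/ft0].
  - by move=> x _; exact: epow_ge0.
  - by move=> x /Ak[h _]; rewrite /half_space/=; exact: lt_le_trans h.
have gam0 : 0 < gam := lt_trans ltr01 g1.
have Tv x : D x -> (0 < T (cand gam v) x)%E /\ T (cand gam v) x \is a fin_num.
  move=> Dx; split.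
    exact: (transform_cand_gt0 beta m0 lam0 g1 l0 c0 tF).
  exact: (transform_cand_fin beta m0 lam0 g1 lamgam l0 tF).
have H := energy_dilation q r0 rho0 mft (fun y => ltW (ft0 y))
  (measurable_cand gam tF) (fun y => powR_ge0 _ _) ftF Tv.
rewrite H.
(* the exponents of [r] cancel: invariance under dilations *)
suff -> : r ^+ m.+1 * (r ^+ m * (r `^ beta * r `^ lambda) * rho) `^ q = 1.
  by rewrite mul1e.
have rn0 : r != 0 by rewrite gt_eqF.
have P (x y : R) : r `^ x * r `^ y = r `^ (x + y).
  by rewrite powRD// rn0 implybT.
rewrite -!powR_mulrn ?(ltW r0)// /rho !P -powRrM P.
have -> : m.+1%:R + (m%:R + (beta + lambda) + - (m%:R / p)) * q = 0.
  rewrite -hom; ring.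
by rewrite powRr0.
Qed.

End reduction.

(** * Existence of a minimizer *)

Section maximizer.
Context (R : realType) (m : nat).
Notation LX := (lebesgue_tuple R m.+1).
Notation LY := (lebesgue_tuple R m).
Notation D := (half_space R m.+1).
Variables (lambda beta p q : R).
Hypothesis m0 : (0 < m)%N.
Hypothesis lam0 : 0 < lambda.
Hypothesis beta0 : 0 <= beta.
Hypothesis p01 : 0 < p < 1.
Hypothesis q0 : q < 0.
Hypothesis bq : -1 < beta * q.
Hypothesis lq : m.+1%:R + beta * q < - (lambda * q).
Let gam := (1 - p)^-1.
Hypothesis lamgam : m%:R < lambda * (gam - 1).
Hypothesis hom : q * (m%:R / p - (lambda + beta + m%:R)) = m.+1%:R.
Let T := transform LY (hs_kernel (m := m) lambda beta).

Definition unit_mass (f : Rn R m -> R) : Prop :=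
  [/\ measurable_fun [set: Rn R m] f, forall y, 0 <= f y &
      (\int[LY]_y ((f y) `^ p)%:E = 1)%E].

(** The kernel is positive on the half-space, so a vanishing transform would force
    [f] to vanish almost everywhere. *)
Lemma transform_gt0 f x : unit_mass f -> D x -> (0 < T f x)%E.
Proof.
move=> [mf f0 fp] Dx; have x0 : 0 < (x`_m : R) := Dx.
have p0 : p != 0 by case/andP : p01 => /lt0r_neq0.
rewrite lt0e transform_ge0 ?andbT//; last by move=> *; exact: hs_kernel_ge0.
apply/eqP => Tf0.
have mKf : measurable_fun [set: Rn R m] (fun y => (hs_kernel lambda beta x y * f y)%:E).
  apply/measurable_EFinP; apply: measurable_funM => //.
  exact: (measurable_kernel_section (@measurable_hs_kernel R m lambda beta)).
have /(ae_eq_integral_abs LY measurableT mKf).1 ae0 :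
    (\int[LY]_y `|(hs_kernel lambda beta x y * f y)%:E| = 0)%E.
  rewrite -[RHS]Tf0; apply: eq_integral => y _.
  by rewrite gee0_abs// lee_fin mulr_ge0 ?hs_kernel_ge0.
have : (\int[LY]_y ((f y) `^ p)%:E = \int[LY]_y (cst 0%E) y)%E.
  apply: ae_eq_integral => //.
    by apply/measurable_EFinP; apply: (measurableT_comp (measurable_powR _)).
  apply: filterS ae0 => y /= /(_ I) [/eqP]; rewrite mulf_eq0 => /orP[|/eqP ->]; last first.
    by rewrite powR0.
  rewrite gt_eqF// mulr_gt0 ?powR_gt0//.
  exact: lt_le_trans (le_last_edist_boundary x y).
by rewrite fp integral_cst// mul0e => /eqP; rewrite eqe oner_eq0.
Qed.

(** The truncations exhaust the set of finiteness of the transform; outside of it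
    the integrand [(+oo) `^ q] is [0]. *)
Lemma energy_le_truncations f (E : \bar R) : unit_mass f -> (0 <= E)%E ->
  (forall k : nat, (\int[LX]_(x in truncation lambda beta f k.+1%:R) epow (T f x) q <= E)%E) ->
  (energy lambda beta q f <= E)%E.
Proof.
move=> uf E0 fE; have [mf f0 fp] := uf.
have mT : measurable_fun [set: Rn R m.+1] (fun x => epow (T f x) q).
  apply: (measurableT_comp (measurable_epow _)).
  apply: measurable_transform; [exact: measurable_hs_kernel|
      exact: hs_kernel_ge0|exact: mf|exact: f0].
pose A (k : nat) := truncation lambda beta f (k.+1%:R : R).
have -> : energy lambda beta q f = (\int[LX]_(x in \bigcup_k A k) epow (T f x) q)%E.
  rewrite /energy integral_mkcond [RHS]integral_mkcond.
  apply: eq_integral => x _; rewrite !patchE.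
  case: ifPn => [/[1!inE] Dx|nD]; last first.
    case: ifPn => // /[1!inE] -[k _ [h _ _]].
    exfalso; move/negP : nD; apply; rewrite inE.
    by rewrite /half_space/=; apply: lt_le_trans h; rewrite invr_gt0.
  case: ifPn => // nA.
  have Tx := transform_gt0 uf Dx.
  suff TE : T f x = +oo%E.
    by move: TE; rewrite /T => ->; rewrite /epow q0.
  apply/eqP; rewrite eq_le leey/= leNgt; apply/negP => Too.
  move/negP : nA; apply; rewrite inE.
  have x0 : 0 < (x`_m : R) := Dx.
  have e0 := edist_ge0 x (origin R m.+1).
  rewrite -/(T f x) in Tx Too *.
  case E1 : (T f x) Tx Too => [t| |]// t0 _; rewrite lte_fin in t0.
  (* any index above [B] puts [x] in the corresponding truncation *)
  pose B := (x`_m : R)^-1 + edist x (origin R m.+1) + t + t^-1.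
  have ix0 : 0 < (x`_m : R)^-1 by rewrite invr_gt0.
  have it0 : 0 < t^-1 by rewrite invr_gt0.
  have [k Bk] : exists k : nat, B <= k.+1%:R.
    by exists (Num.truncn B); apply: ltW; exact: truncnS_gt.
  have kinv (s : R) : 0 < s -> s^-1 <= B -> k.+1%:R^-1 <= s.
    by move=> s0 sB; rewrite invf_ple ?posrE//; exact: le_trans Bk.
  exists k => //; split.
  - by apply: kinv => //; rewrite /B; lra.
  - by apply: le_trans Bk; rewrite /B; lra.
  - rewrite -/(T f x) E1 !lee_fin; apply/andP; split.
      by apply: kinv => //; rewrite /B; lra.
    by apply: le_trans Bk; rewrite /B; lra.
apply: ge0_integral_bigcup_le => //.
- apply/nondecreasing_seqP => k; apply/subsetPset => x [h1 h2 /andP[h3 h4]].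
  have kk : (k.+1%:R : R) <= k.+2%:R by rewrite ler_nat.
  have ik : (k.+2%:R^-1 : R) <= k.+1%:R^-1 by rewrite lef_pV2 ?posrE.
  split; [exact: le_trans h1|exact: le_trans kk|].
  by rewrite (le_trans _ h3) ?lee_fin// (le_trans h4)// lee_fin.
- by move=> k; exact: measurable_truncation.
- by move=> x; exact: epow_ge0.
Qed.

Lemma unit_mass_cube : unit_mass (\1_(cube (R := R) (m := m) 0)).
Proof.
have p0 : p != 0 by case/andP : p01 => /lt0r_neq0.
split.
- by apply: measurable_indic; exact: measurable_cube.
- by move=> y; rewrite indicE.
- rewrite (eq_integral (EFin \o \1_(cube (R := R) (m := m) 0))).
    by rewrite integral_indic ?setIT//; [exact: lebesgue_cube|exact: measurable_cube].
  move=> y _; rewrite /= indicE.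
  by case: (_ \in _); rewrite ?powR1// powR0.
Qed.

(** By reduction it is enough to maximize over the compact class. That class is
    empty only if no truncated energy is positive, in which case all energies
    vanish and any normalized function, such as the indicator of a cube, is
    optimal. *)
Lemma energy_maximizer : exists2 F, unit_mass F &
  forall f, unit_mass f -> (energy lambda beta q f <= energy lambda beta q F)%E.
Proof.
have [l0 c0 M0] := class_constants_gt0 m0 lamgam.
have g1 := conjugate_exponent_gt1 p01.
have energy0 f : (0 <= energy lambda beta q f)%E.
  by apply: integral_ge0 => x _; exact: epow_ge0.
have k1 (k : nat) : 1 <= k.+1%:R :> R by rewrite ler1n.
have red f : unit_mass f -> forall k : nat,
    (\int[LX]_(x in truncation lambda beta f k.+1%:R) epow (T f x) q <= 0)%E \/
    exists2 u : Rn R m -> R, normalized lambda gam (class_lower m lambda p)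
        (class_upper m lambda p) (class_modulus m lambda p) u &
      (\int[LX]_(x in truncation lambda beta f k.+1%:R) epow (T f x) q <=
        energy lambda beta q (cand gam u))%E.
  move=> [mf f0 fp] k; have [I0|I0] := leP (\int[LX]_(x in truncation lambda beta f k.+1%:R) epow (T f x) q)%E 0%E.
    by left.
  right; exact: (truncation_reduction m0 lam0 beta0 p01 q0 lamgam hom mf f0 fp (k1 k) I0).
have [ex|nex] := pselect (exists u : Rn R m -> R, normalized lambda gam
    (class_lower m lambda p) (class_upper m lambda p) (class_modulus m lambda p) u).
  have [u [tu nu] umax] := energy_attained m0 lam0 beta0 g1 lamgam q0 bq lq l0 c0 M0 ex.
  exists (cand gam u).
    split; [exact: measurable_cand tu|by move=> y; exact: powR_ge0|].
    rewrite -nu; apply: eq_integral => y _.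
    by rewrite /cand -powRrM mulNr (conjugate_exponentE p01).
  move=> f uf; apply: (energy_le_truncations uf) => [|k]; first exact: energy0.
  have [I0|[v nv]] := red _ uf k; first exact: le_trans I0 _.
  by move=> /le_trans; apply; exact: umax.
exists (\1_(cube (R := R) (m := m) 0)); first exact: unit_mass_cube.
move=> f uf; apply: (@le_trans _ _ 0%E); last exact: energy0.
apply: (energy_le_truncations uf) => [|k]; first exact: lexx.
by have [//|[u nu _]] := red _ uf k; exfalso; apply: nex; exists u.
Qed.

End maximizer.

Section matching_the_statement.
Context (R : realType) (m : nat) (alpha beta p q : R).

Lemma T_opE (f : Rn R m -> R) : T_op m.+1 alpha beta f =
  transform (lebesgue_tuple R m) (hs_kernel (alpha - m.+1%:R) beta) f.
Proof.
apply/funext => x; apply: eq_integral => y _; congr (_%:E).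
rewrite /hs_kernel /= -[m.+1%:R - alpha]opprB powRN invrK.
by [].
Qed.

Lemma Lp_boundary_eq1 (f : Rn R m -> R) : 0 < p ->
  Lp_boundary m.+1 p f = 1%E <-> (\int[lebesgue_tuple R m]_y ((f y) `^ p)%:E = 1)%E.
Proof.
move=> p0; have ip0 : 0 < p^-1 by rewrite invr_gt0.
rewrite /Lp_boundary /Lsnorm epow_pos//=.
have -> : (\int[lebesgue_tuple R m]_y epow (f y)%:E p =
    \int[lebesgue_tuple R m]_y ((f y) `^ p)%:E)%E.
  by apply: eq_integral => y _; rewrite epow_pos.
have : (0 <= \int[lebesgue_tuple R m]_y ((f y) `^ p)%:E)%E.
  by apply: integral_ge0 => y _; rewrite lee_fin powR_ge0.
set I := (\int[_]_y _)%E => I0; split => [H|->]; last by rewrite poweR1r.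
have : (I `^ p^-1 `^ p)%E = (1 `^ p)%E by rewrite H.
by rewrite -poweRrM mulVf ?gt_eqF// poweRe1// poweR1r.
Qed.

End matching_the_statement.

Theorem theorem1p2 (R : realType) (n : nat) (alpha beta p q : R)
    (hn : (2 <= n)%N) (halpha : n%:R < alpha)
    (hbeta0 : 0 <= beta) (hbeta : beta < (alpha - n%:R) / (n%:R - 1))
    (hp0 : 0 < p) (hp1 : p < 1)
    (hp : (n%:R - 1) / (alpha - 1 - (n%:R - 1) * beta) < p)
    (hq0 : q < 0)
    (hq : q^-1 =
          (n%:R - 1) / n%:R * (p^-1 - (alpha + beta - 1) / (n%:R - 1))) :
  exists f : Rn R n.-1 -> R,
    [/\ measurable_fun [set: Rn R n.-1] f,
        forall y, 0 <= f y,
        Lp_boundary n p f = 1%E &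
        Lq_half_space n q (T_op n alpha beta f) = Cstar n alpha beta p q].
Proof.
have bq1 := beta_q_gt0 hn halpha hbeta0 hbeta hp hp1 hq0 hq.
case: n hn halpha hbeta hp hq bq1 => [|m]// hn halpha hbeta hp hq bq1 /=.
have m0 : (0 < m)%N by [].
have mR : 1 <= m%:R :> R by rewrite ler1n.
have nE : m.+1%:R = m%:R + 1 :> R by rewrite natr1.
pose lambda := alpha - m.+1%:R.
have lam0 : 0 < lambda by rewrite subr_gt0.
have aE : alpha = lambda + m%:R + 1 by rewrite /lambda nE; ring.
have mnE : m.+1%:R - 1 = m%:R :> R by rewrite nE; ring.
rewrite mnE in hbeta hp hq.
have mbl : m%:R * beta < lambda.
  by move: hbeta; rewrite -/lambda ltr_pdivlMr; [lra|lra].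
have p01 : 0 < p < 1 by rewrite hp0.
have den : 0 < alpha - 1 - m%:R * beta by rewrite aE; lra.
have mp : m%:R < p * (lambda + m%:R).
  move: hp; rewrite ltr_pdivrMr// aE => h.
  have : 0 <= p * (m%:R * beta) by apply: mulr_ge0; [exact: ltW|exact: mulr_ge0].
  lra.
(* [L^p]-integrability of [(1 + |y|) `^ (- lambda / (1 - p))] *)
have lamgam : m%:R < lambda * ((1 - p)^-1 - 1).
  have p1 : 0 < 1 - p by lra.
  have -> : lambda * ((1 - p)^-1 - 1) = (lambda * p) / (1 - p) by field; rewrite gt_eqF.
  by rewrite ltr_pdivlMr//; lra.
(* the homogeneity relation defining [q] *)
have hom : q * (m%:R / p - (lambda + beta + m%:R)) = m.+1%:R.
  have E : m%:R / p - (lambda + beta + m%:R) = m.+1%:R * q^-1.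
    rewrite hq aE nE; field; rewrite (gt_eqF hp0)/=; apply/andP; split; apply/eqP; lra.
  by rewrite E mulrCA mulfV ?mulr1// lt_eqF.
(* decay of the majorant at infinity: this is where [p < 1] enters *)
have lq : m.+1%:R + beta * q < - (lambda * q).
  have mpm : 0 < m%:R / p - m%:R by rewrite subr_gt0 ltr_pdivlMr//; nra.
  have : q * (m%:R / p - m%:R) < 0 by rewrite nmulr_rlt0.
  move: hom; lra.
have bq : -1 < beta * q by lra.
have [F [mF F0 Fp] Fmax] := energy_maximizer m0 lam0 hbeta0 p01 hq0 bq lq lamgam hom.
have LqE f : Lq_half_space m.+1 q (T_op m.+1 alpha beta f) =
    epow (energy lambda beta q f) q^-1.
  by rewrite T_opE.
exists F; split => //; first exact/(Lp_boundary_eq1 _ hp0).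
apply/eqP; rewrite eq_le; apply/andP; split; last first.
  apply: ereal_inf_lbound; exists F; last by reflexivity.
  by split; [exact: mF|exact: F0|exact/(Lp_boundary_eq1 _ hp0)].
apply: le_ereal_inf_tmp => _ [f [mf f0 fp] <-]; rewrite !LqE.
apply: epow_le_neg; first by rewrite invr_lt0.
  by apply: integral_ge0 => x _; exact: epow_ge0.
by apply: Fmax; split => //; exact/(Lp_boundary_eq1 _ hp0).
Qed.
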